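(* Let $G=(V,E)$ be a finite connected graph with $n=|V|$, $m=|E|\ge1$ and maximum degree $\Delta$; let $0<\beta<\infty$, $x=\tanh\beta$, and $\epsilon,\delta\in(0,1)$. Let $(X_t)_{t\in\mathbb{N}}$ be the worm process on $G$ with parameter $x$ started from $X_0=\mathbf{0}$. Set $$\tau=\left\lceil 4\left(\log 2+\frac{\log(2\delta^{-1})}{m}\right)\Delta\,m^2\,n^4\right\rceil,\qquad N=\left\lceil 16\,\epsilon^{-2}(1+\epsilon)^2\delta^{-1}\Delta\,m\,n^5\right\rceil,$$ $$\hat S_0=\frac1N\sum_{t=\tau+1}^{\tau+N}\mathbf{1}_{\mathcal{C}_0}(X_t).$$ Then $1/\hat S_0$ is an $(\epsilon,\delta)$-approximation of the zero-field Ising susceptibility $\chi_\beta$, i.e. $$\mathbb{P}\left(\left|\frac{1}{\hat S_0}-\chi_\beta\right|\le\epsilon\,\chi_\beta\right)\ge 1-\delta,$$ and the number of steps of the worm process used is $N+\tau=O(\delta^{-1}\epsilon^{-2}\Delta\,m^2\,n^4)$, with an absolute implied constant. In particular this procedure defines a fully-polynomial randomized approximation scheme for $\chi_\beta$.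
   Context: Graphs are simple and undirected; $d(v)$ is the degree of $v$ in $G$. The zero-field ferromagnetic Ising model on $G$ is the probability measure on $\{-1,+1\}^V$ with $\mathbb{P}_\beta(\sigma)\propto\exp(\beta\sum_{ij\in E}\sigma_i\sigma_j)$; the susceptibility is $\chi_\beta=\frac1n\mathrm{var}_\beta(\mathcal{M})$ where $\mathcal{M}(\sigma)=\sum_{i\in V}\sigma_i$. For $A\subseteq E$, $\partial A\subseteq V$ denotes the set of vertices of odd degree in $(V,A)$. Let $\mathcal{C}_0=\{A\subseteq E:\partial A=\emptyset\}$, $\mathcal{C}_2=\{A\subseteq E:|\partial A|=2\}$, $\mathcal{W}=\mathcal{C}_0\cup\mathcal{C}_2$; the empty edge set as an element of $\mathcal{W}$ is denoted $\mathbf{0}$. $\triangle$ is symmetric difference and $A\triangle uv$ means $A\triangle\{uv\}$. The worm process with parameter $x\in(0,1)$ is the Markov chain on $\mathcal{W}$ with transition matrix $P_x$ whose off-diagonal entries are, for an edge $uv\in E$ and $A,\,A\triangle uv\in\mathcal{W}$: (i) if $A\in\mathcal{C}_0$: $P_x(A,A\triangle uv)=x^{\mathbf{1}(uv\notin A)}\frac{1}{2n}\left(\frac1{d(u)}+\frac1{d(v)}\right)$; (ii) if $A\triangle uv\in\mathcal{C}_0$: $P_x(A,A\triangle uv)=x^{\mathbf{1}(uv\notin A)}\frac14\left(\frac1{d(u)}+\frac1{d(v)}\right)$; (iii) if $A\in\mathcal{C}_2$, $A\triangle uv\in\mathcal{C}_2$ and $u\in\partial A$: $P_x(A,A\triangle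 uv)=\min\left(\frac{d(u)}{d(v)}x^{\mathbf{1}(uv\notin A)-\mathbf{1}(uv\in A)},1\right)\frac{1}{4d(u)}$. All other off-diagonal entries are zero, and the diagonal entries are determined by the rows summing to 1. A random $\hat y$ is an $(\epsilon,\delta)$-approximation of $y>0$ if $|\hat y-y|\le\epsilon y$ with probability at least $1-\delta$ (the event $\hat S_0=0$ counts as failure). A fully-polynomial randomized approximation scheme is a randomized algorithm which, for arbitrary $(\epsilon,\delta)$, outputs an $(\epsilon,\delta)$-approximation in time polynomial in $n$, $\epsilon^{-1}$, $\delta^{-1}$; time here is measured by the number of steps of the worm process. *)

(* Defs.v *)
From mathcomp Require Import all_boot all_order all_algebra.
From mathcomp Require Import all_classical all_reals all_analysis.

Set Implicit Arguments.
Unset Strict Implicit.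
Unset Printing Implicit Defensive.

Import Order.TTheory GRing.Theory Num.Theory.

Local Open Scope ring_scope.

Record sgraph := SGraph {
  vertex :> finType;
  adj : rel vertex;
  adj_sym : symmetric adj;
  adj_irr : irreflexive adj }.

Section Graph.
Variable G : sgraph.

Definition connected_graph : Prop := forall u v : G, connect (@adj G) u v.

Definition edges : {set {set G}} :=
  [set e | [exists u : G, exists v : G, adj u v && (e == [set u; v])]].

Definition degree (v : G) : nat := #|[set u : G | adj v u]|.

Definition max_degree : nat := \max_(v : G) degree v.

Definition symdiff (A B : {set {set G}}) : {set {set G}} :=
  (A :\: B) :|: (B :\: A).

Definition odd_vertices (A : {set {set G}}) : {set G} :=
  [set v : G | odd #|[set e in A | v \in e]|].

Definition C0 : {set {set {set G}}} :=
  [set A in powerset edges | odd_vertices A == finset.set0].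

Definition C2 : {set {set {set G}}} :=
  [set A in powerset edges | #|odd_vertices A| == 2].

Definition worm_space : {set {set {set G}}} := C0 :|: C2.

Definition worm_state : Type := {A : {set {set G}} | A \in worm_space}.

Lemma set0_worm_space : finset.set0 \in worm_space.
Proof.
rewrite inE; apply/orP; left; rewrite inE powersetE finset.sub0set /=.
apply/eqP/setP => v; rewrite !inE (_ : #|_| = 0) //.
by apply: eq_card0 => e; rewrite !inE.
Qed.

Definition worm0 : worm_state := exist _ finset.set0 set0_worm_space.

End Graph.

Section Ising.
Variables (R : realType) (G : sgraph).

(* A configuration is a map to bool; the spin of b is (-1) ^+ b. *)
Definition spin (s : {ffun G -> bool}) (v : G) : R := (-1) ^+ s v.

Definition ising_weight (beta : R) (s : {ffun G -> bool}) : R :=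
  expR (beta * \sum_(e in edges G) \prod_(v in e) spin s v).

Definition ising_prob (beta : R) (s : {ffun G -> bool}) : R :=
  ising_weight beta s / \sum_(s' : {ffun G -> bool}) ising_weight beta s'.

Definition ising_mean (beta : R) (f : {ffun G -> bool} -> R) : R :=
  \sum_(s : {ffun G -> bool}) ising_prob beta s * f s.

Definition ising_var (beta : R) (f : {ffun G -> bool} -> R) : R :=
  ising_mean beta (fun s => (f s - ising_mean beta f) ^+ 2).

Definition magnetization (s : {ffun G -> bool}) : R := \sum_(v : G) spin s v.

Definition susceptibility (beta : R) : R :=
  ising_var beta magnetization / #|G|%:R.

End Ising.

Definition tanhR (R : realType) (b : R) : R :=
  (expR b - expR (- b)) / (expR b + expR (- b)).

Section WormTransition.
Variables (R : realType) (G : sgraph) (x : R).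

(* Transition rate from A to A /_\ {uv}.  In the last case (A and A /_\ {uv}
   both in C2) it is the intended one only if u is odd in A. *)
Definition worm_rate (A : {set {set G}}) (u v : G) : R :=
  let uv := [set u; v] in
  let du : R := (degree u)%:R in
  let dv : R := (degree v)%:R in
  if A \in C0 G then
    x ^+ (uv \notin A) * (1 / (2 * #|G|%:R)) * (du^-1 + dv^-1)
  else if symdiff A [set uv] \in C0 G then
    x ^+ (uv \notin A) * (1 / 4) * (du^-1 + dv^-1)
  else
    Num.min (du / dv * x ^ ((uv \notin A)%:Z - (uv \in A)%:Z)) 1
      * (1 / (4 * du)).

(* (u, v) is an orientation of the edge by which A and B differ, starting at
   an odd vertex of A if A and B are both in C2; in that case it is unique,
   otherwise the choice between (u, v) and (v, u) does not matter since the
   rate is symmetric: see the lemmas worm_transition_C0, worm_transition_toC0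
   and worm_transition_C2 below. *)
Definition worm_move (A B : worm_state G) (uv : G * G) : bool :=
  [&& adj uv.1 uv.2, val B == symdiff (val A) [set [set uv.1; uv.2]] &
      (val A \in C2 G) && (val B \in C2 G) ==> (uv.1 \in odd_vertices (val A))].

Definition worm_offdiag (A B : worm_state G) : R :=
  if [pick uv | worm_move A B uv] is Some (u, v) then worm_rate (val A) u v
  else 0.

Definition worm_transition (A B : worm_state G) : R :=
  if A == B then 1 - \sum_(D : worm_state G | D != A) worm_offdiag A D
  else worm_offdiag A B.

End WormTransition.

Section WormTransitionTheory.
Variables (R : realType) (G : sgraph) (x : R).
Implicit Types (A B : worm_state G) (u v : G).

Lemma symdiff1E (A : {set {set G}}) e f :
  (f \in symdiff A [set e]) = (f \in A) (+) (f == e).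
Proof. by rewrite !inE; case: (f \in A); case: (f == e). Qed.

Lemma symdiff1_inj (A : {set {set G}}) e f :
  symdiff A [set e] = symdiff A [set f] -> e = f.
Proof.
move=> /setP /(_ e); rewrite !symdiff1E eqxx => /addbI /esym.
by move=> /eqP.
Qed.

Lemma odd_vertices_symdiff1 (A : {set {set G}}) e v :
  (v \in odd_vertices (symdiff A [set e])) = (v \in odd_vertices A) (+) (v \in e).
Proof.
rewrite !inE.
pose S := [set f in A | v \in f]; pose S' := [set f in symdiff A [set e] | v \in f].
have hD : S' :\ e = S :\ e.
  by apply/setP => f; rewrite !inE; case: (f == e); case: (f \in A).
rewrite -/S -/S' (cardsD1 e S') (cardsD1 e S) hD !inE eqxx.
by rewrite !oddD; case: (e \in A); case: (v \in e); case: (odd #|S :\ e|).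
Qed.

Lemma set2_orient (u v a b : G) : u != v -> [set u; v] = [set a; b] ->
  (a = u /\ b = v) \/ (a = v /\ b = u).
Proof.
move=> uv /setP h.
have := h u; have := h v; rewrite !inE !eqxx orbT /= => /esym hv /esym hu.
case/orP: hu => /eqP hu; case/orP: hv => /eqP hv.
- by move: uv; rewrite hu hv eqxx.
- by left.
- by right.
- by move: uv; rewrite hu hv eqxx.
Qed.

Lemma adj_neq u v : adj u v -> u != v.
Proof. by apply: contraTneq => ->; rewrite adj_irr. Qed.

Lemma symdiff1_neq A B u v :
  val B = symdiff (val A) [set [set u; v]] -> A != B.
Proof.
move=> h; apply/eqP => AB; move: h; rewrite -AB => /setP /(_ [set u; v]).
by rewrite symdiff1E eqxx; case: (_ \in _).
Qed.

Lemma C0_notC2 (A : {set {set G}}) : A \in C0 G -> A \notin C2 G.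
Proof. by rewrite !inE => /andP[-> /eqP ->]; rewrite cards0. Qed.

Lemma worm_rate_sym A B u v : (val A \in C0 G) || (val B \in C0 G) ->
  val B = symdiff (val A) [set [set u; v]] ->
  worm_rate x (val A) v u = worm_rate x (val A) u v.
Proof.
move=> h hB; rewrite /worm_rate [[set v; u]]finset.setUC -hB.
case: ifP h => [_ _|_ /= ->]; by rewrite [_^-1 + _]addrC.
Qed.

Lemma worm_transition_rate A B u v :
  adj u v -> val B = symdiff (val A) [set [set u; v]] ->
  ((val A \in C2 G) && (val B \in C2 G) ==> (u \in odd_vertices (val A))) ->
  worm_transition x A B = worm_rate x (val A) u v.
Proof.
move=> uv hB h; rewrite /worm_transition (negPf (symdiff1_neq hB)) /worm_offdiag.
case: pickP => [[a b] /and3P[/= ab /eqP hB' h']|/(_ (u, v))]; last first.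
  by rewrite /worm_move /= uv hB eqxx -hB h.
have e := symdiff1_inj (etrans (esym hB) hB').
case: (set2_orient (adj_neq uv) e) => [] [? ?]; subst a b => //.
case: (boolP ((val A \in C0 G) || (val B \in C0 G))) => [h0|].
  exact: worm_rate_sym hB.
rewrite negb_or => /andP[A0 B0].
have A2 : val A \in C2 G by have := valP A; rewrite finset.in_setU (negPf A0).
have B2 : val B \in C2 G by have := valP B; rewrite finset.in_setU (negPf B0).
move: h h'; rewrite A2 B2 /= => hu hv.
have sub : [set u; v] \subset odd_vertices (val A).
  by apply/fintype.subsetP => w; rewrite !inE => /orP[]/eqP ->; move: hu hv; rewrite !inE.
have oA : odd_vertices (val A) = [set u; v].
  apply/esym/eqP; rewrite eqEcard sub cards2 (adj_neq uv).
  by move: A2; rewrite inE => /andP[_ /eqP ->].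
have oB : odd_vertices (val B) = finset.set0.
  apply/setP => w; rewrite hB odd_vertices_symdiff1 oA addbb.
  by rewrite finset.in_set0.
by move: B2; rewrite inE oB cards0 andbF.
Qed.

Lemma worm_transition_C0 A B u v :
  adj u v -> val B = symdiff (val A) [set [set u; v]] -> val A \in C0 G ->
  worm_transition x A B = x ^+ ([set u; v] \notin val A)
    * (1 / (2 * #|G|%:R)) * ((degree u)%:R^-1 + (degree v)%:R^-1).
Proof.
move=> uv hB A0; rewrite (worm_transition_rate uv hB) ?(negPf (C0_notC2 A0)) //.
by rewrite /worm_rate A0.
Qed.

Lemma worm_transition_toC0 A B u v :
  adj u v -> val B = symdiff (val A) [set [set u; v]] -> val B \in C0 G ->
  worm_transition x A B = x ^+ ([set u; v] \notin val A)
    * (1 / 4) * ((degree u)%:R^-1 + (degree v)%:R^-1).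
Proof.
move=> uv hB B0; rewrite (worm_transition_rate uv hB).
  rewrite /worm_rate -hB B0 ifF //; apply/negP => A0.
  move: A0 B0; rewrite !inE => /andP[_ /eqP oA] /andP[_ /eqP/setP/(_ u)].
  by rewrite hB odd_vertices_symdiff1 oA !inE eqxx.
by rewrite (negPf (C0_notC2 B0)) andbF.
Qed.

Lemma worm_transition_C2 A B u v :
  adj u v -> val B = symdiff (val A) [set [set u; v]] ->
  val A \in C2 G -> val B \in C2 G -> u \in odd_vertices (val A) ->
  worm_transition x A B =
    Num.min ((degree u)%:R / (degree v)%:R
             * x ^ (([set u; v] \notin val A)%:Z - ([set u; v] \in val A)%:Z)) 1
      * (1 / (4 * (degree u)%:R)).
Proof.
move=> uv hB A2 B2 hu; rewrite (worm_transition_rate uv hB) ?hu ?implybT //.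
rewrite /worm_rate -hB.
have /negPf -> : val A \notin C0 G by apply: contraL A2; exact: C0_notC2.
by have /negPf -> : val B \notin C0 G by apply: contraL B2; exact: C0_notC2.
Qed.

Lemma worm_transition_eq0 A B : A != B ->
  (forall u v, adj u v -> val B <> symdiff (val A) [set [set u; v]]) ->
  worm_transition x A B = 0.
Proof.
move=> /negPf AB h; rewrite /worm_transition AB /worm_offdiag.
by case: pickP => // -[u v] /and3P[/= uv /eqP hB _]; case: (h _ _ uv hB).
Qed.

Lemma worm_transition_sum1 A : \sum_(B : worm_state G) worm_transition x A B = 1.
Proof.
rewrite (bigD1 A) //= {1}/worm_transition eqxx.
rewrite [X in _ + X](eq_bigr (worm_offdiag x A)) ?subrK // => B BA.
by rewrite /worm_transition eq_sym (negPf BA).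
Qed.

End WormTransitionTheory.

(* X is a Markov chain on (Omega, P) with transition matrix p, started almost
   surely from a0.  The Markov property is written in product form, so that
   nothing is required of trajectories of probability zero. *)
Definition markov_chain (R : realType) (S : finType)
    (d : measure_display) (Omega : measurableType d) (P : probability Omega R)
    (p : S -> S -> R) (a0 : S) (X : nat -> Omega -> S) : Prop :=
  [/\ forall (t : nat) (a : S), measurable [set w | X t w = a]%classic,
      P [set w | X 0%N w = a0]%classic = 1%E &
      forall (k : nat) (a : nat -> S),
        P [set w | forall t : nat, (t <= k.+1)%N -> X t w = a t]%classic =
        (P [set w | forall t : nat, (t <= k)%N -> X t w = a t]%classic
           * (p (a k) (a k.+1))%:E)%E].

Definition worm_process (R : realType) (G : sgraph) (x : R)
    (d : measure_display) (Omega : measurableType d) (P : probability Omega R)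
    (X : nat -> Omega -> worm_state G) : Prop :=
  markov_chain P (worm_transition x) (worm0 G) X.

Section Estimator.
Variables (R : realType) (G : sgraph).

(* The arguments of Num.ceil are nonnegative when 0 < delta < 1, so absz only
   converts to nat. *)
Definition burn_in (delta : R) : nat :=
  let m : R := #|edges G|%:R in
  let n : R := #|G|%:R in
  `|Num.ceil (4 * (ln 2 + ln (2 * delta^-1) / m)
              * (max_degree G)%:R * m ^+ 2 * n ^+ 4)|%N.

Definition sample_size (eps delta : R) : nat :=
  let m : R := #|edges G|%:R in
  let n : R := #|G|%:R in
  `|Num.ceil (16 * eps ^- 2 * (1 + eps) ^+ 2 * delta^-1
              * (max_degree G)%:R * m * n ^+ 5)|%N.

Definition S0_hat (eps delta : R) (traj : nat -> worm_state G) : R :=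
  let tau := burn_in delta in
  let N := sample_size eps delta in
  N%:R^-1 * \sum_(tau.+1 <= t < (tau + N).+1) (val (traj t) \in C0 G)%:R.

End Estimator.

(* An algorithm driven by the worm process: on input (G, beta, eps, delta) it
   runs the process with parameter tanh beta from the empty edge set for
   run_length steps and returns a function of the trajectory. *)
Record worm_algorithm (R : realType) := WormAlgorithm {
  run_length : forall (G : sgraph) (beta eps delta : R), nat;
  run_output : forall (G : sgraph) (beta eps delta : R),
    (nat -> worm_state G) -> R }.

(* A failed run may be coded by the output 0: if 0 < y and eps < 1, then 0 is
   never within eps * y of y. *)
Definition eps_delta_approximation (R : realType)
    (d : measure_display) (Omega : measurableType d) (P : probability Omega R)
    (eps delta y : R) (yhat : Omega -> R) : Prop :=
  ((1 - delta)%:E <= P [set w | (`|yhat w - y| <= eps * y)%R]%classic)%E.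

(* The polynomial p is in the three variables n, eps^-1 and delta^-1. *)
Definition fpras (R : realType) (y : sgraph -> R -> R)
    (alg : worm_algorithm R) : Prop :=
  exists p : {poly {poly {poly R}}},
  forall (G : sgraph) (beta eps delta : R),
    connected_graph G -> (1 <= #|edges G|)%N -> 0 < beta ->
    0 < eps < 1 -> 0 < delta < 1 ->
    [/\ (run_length alg G beta eps delta)%:R
          <= p.[#|G|%:R].[(eps^-1)%:P].[delta^-1],
        forall traj traj' : nat -> worm_state G,
          (forall t : nat, (t <= run_length alg G beta eps delta)%N ->
             traj t = traj' t) ->
          run_output alg beta eps delta traj
            = run_output alg beta eps delta traj' &
        forall (d : measure_display) (Omega : measurableType d)
          (P : probability Omega R) (X : nat -> Omega -> worm_state G),
          worm_process (tanhR beta) P X ->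
          eps_delta_approximation P eps delta (y G beta)
            (fun w => run_output alg beta eps delta (X ^~ w))].

Definition susceptibility_algorithm (R : realType) : worm_algorithm R :=
  {| run_length := fun G beta eps delta =>
       (sample_size G eps delta + burn_in G delta)%N;
     run_output := fun G beta eps delta traj => (S0_hat eps delta traj)^-1 |}.

(* Main.v *)
Require Import Defs.
From mathcomp Require Import all_boot all_order all_algebra.
From mathcomp Require Import all_classical all_reals all_analysis.
From mathcomp Require Import ring lra zify.

Set Implicit Arguments.
Unset Strict Implicit.
Unset Printing Implicit Defensive.

Import Order.TTheory GRing.Theory Num.Theory.

Local Open Scope ring_scope.

(** The worm chain is reversible with respect to the weights [worm_weight],
    which are [x ^+ #|A|] times the number of ordered pairs [(u, v)] whose
    symmetric difference is the set of odd vertices of [A]. Expanding the Ising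
    weights at high temperature turns spin correlations into sums of
    [x ^+ #|A|] over the edge sets with given odd vertices, so that the
    stationary probability of having no odd vertex is exactly the inverse of the
    susceptibility ([worm_law_even]). The fraction of time spent without odd
    vertices thus estimates [1 / susceptibility], and the work is to bound its
    bias and its variance.

    Both follow from a Poincare inequality ([worm_poincare]) with constant
    [4 * Delta * m ^+ 2 * n ^+ 2], which is at most the relaxation time
    [4 * Delta * m * n ^+ 4] used by the algorithm because [m <= n ^+ 2]. It
    is proved with canonical paths from every state [I] to every even edge set
    [F]. The difference [D] of [I] and [F] is itself a state, and removing its
    edges one at a time while staying among the states ([worm_remove_edge])
    leads from [I] to [F]. Among the pairs whose [i]-th step is a given one,
    each is determined by [D]. With [M] the larger state of the step,
    [#|I| + #|F| = #|M| + #|symdiff M D|], so that the congestion of the step is a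
    sum of [x ^+ #|symdiff M D|], again a sum of spin correlations, which are at
    most one ([subgraph_sum_le0], [encoding_sum_le]).

    The chain stays put with probability at least one half, hence is a positive
    operator, and the Poincare inequality makes it a contraction on functions
    of mean zero ([dot_step_step_le]). After the burn-in the chain is within
    [delta / 2] of stationarity, as the empty edge set has stationary probability
    at least [2 ^- m] ([burn_in_mixing]). For the stationary chain, summing the
    geometrically decaying correlations and applying Chebyshev's inequality bounds
    the probability of a large error by another [delta / 2]
    ([tolerance_variance]). The bound on the number of steps uses [n <= 2 * m],
    which holds as a connected graph with an edge has no isolated vertices. *)

(** * Edge sets and their odd vertices *)

Section EdgeSets.
Variable G : sgraph.
Implicit Types (A B D F M : {set {set G}}) (e : {set G}) (u v z : G).

(** The symmetric difference of [[set u]] and [[set v]], empty if [u = v]: the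
    states of the worm chain are the sets of edges whose odd vertices have this
    form, which treats states with and without odd vertices alike. *)
Definition endpoints u v : {set G} := [set z | (z == u) (+) (z == v)].

Lemma in_endpoints u v z : (z \in endpoints u v) = (z == u) (+) (z == v).
Proof. by rewrite inE. Qed.

Lemma endpointsxx u : endpoints u u = finset.set0.
Proof. by apply/setP => z; rewrite !inE addbb. Qed.

Lemma endpointsE u v : u != v -> endpoints u v = [set u; v].
Proof.
move=> uv; apply/setP => z; rewrite !inE.
by have [->|//] := eqVneq z u; rewrite (negPf uv).
Qed.

Lemma in_symdiff A B e : (e \in symdiff A B) = (e \in A) (+) (e \in B).
Proof. by rewrite !inE; case: (e \in A); case: (e \in B). Qed.

Lemma symdiffC A B : symdiff A B = symdiff B A.
Proof. by apply/setP => e; rewrite !in_symdiff addbC. Qed.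

Lemma symdiffA A B D : symdiff A (symdiff B D) = symdiff (symdiff A B) D.
Proof. by apply/setP => e; rewrite !in_symdiff addbA. Qed.

Lemma symdiff0 A : symdiff A finset.set0 = A.
Proof. by apply/setP => e; rewrite in_symdiff finset.in_set0 addbF. Qed.

Lemma symdiffxx A : symdiff A A = finset.set0.
Proof. by apply/setP => e; rewrite in_symdiff finset.in_set0 addbb. Qed.

Lemma symdiffK B : involutive (fun A => symdiff A B).
Proof. by move=> A; rewrite -symdiffA symdiffxx symdiff0. Qed.

Lemma odd_vertices_symdiff A B v :
  (v \in odd_vertices (symdiff A B))
  = (v \in odd_vertices A) (+) (v \in odd_vertices B).
Proof.
rewrite !inE; pose S (X : {set {set G}}) : {set {set G}} := [set e : {set G} in X | v \in e].
rewrite -/(S A) -/(S B) -/(S (symdiff A B)).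
have -> : S (symdiff A B) = (S A :\: S B) :|: (S B :\: S A).
  apply/setP => e; rewrite !inE.
  by case: (e \in A); case: (e \in B); case: (v \in e).
rewrite cardsU (_ : _ :&: _ = finset.set0) ?cards0 ?subn0; last first.
  apply/setP => e; rewrite !inE.
  by case: (e \in A); case: (e \in B); case: (v \in e).
rewrite -(cardsID (S B) (S A)) -(cardsID (S A) (S B)) [S B :&: _]finset.setIC.
by rewrite !oddD; do 3! case: (odd _).
Qed.

Lemma odd_vertices0 : odd_vertices (finset.set0 : {set {set G}}) = finset.set0.
Proof.
apply/setP => v; rewrite -{1}(symdiffxx finset.set0) odd_vertices_symdiff addbb.
by rewrite finset.in_set0.
Qed.

Lemma symdiff_sub A B D : A \subset D -> B \subset D -> symdiff A B \subset D.
Proof.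
move=> /fintype.subsetP AD /fintype.subsetP BD; apply/fintype.subsetP => e.
by rewrite in_symdiff; case: (boolP (e \in A)) => [/AD //|_ /= /BD].
Qed.

Lemma symdiffD1 A e : e \in A -> symdiff A [set e] = A :\ e.
Proof.
move=> eA; apply/setP => f; rewrite in_symdiff !inE.
by have [->|] := eqVneq f e; rewrite ?eA ?addbF.
Qed.

Lemma card_symdiff A D :
  (#|A| + #|symdiff A D| = 2 * #|A :\: D| + #|D|)%N.
Proof.
rewrite -(cardsID D A) -(cardsID A D) /symdiff cardsU [D :&: A]finset.setIC.
rewrite (_ : _ :&: (D :\: A) = finset.set0) ?cards0; first by lia.
by apply/setP => e; rewrite !inE; case: (e \in A); case: (e \in D).
Qed.

(** The size of [A] plus that of its difference with [D] only depends on
    [A :\: D], on which [F] and [M] agree. *)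
Lemma card_symdiff_const F M D : symdiff M F \subset D ->
  (#|F| + #|symdiff F D| = #|M| + #|symdiff M D|)%N.
Proof.
move=> /fintype.subsetP MFD; rewrite !card_symdiff; congr (2 * #|pred_of_set _| + _)%N.
apply/setP => e; rewrite !inE; have := MFD e; rewrite in_symdiff.
by case: (e \in M); case: (e \in F); case: (e \in D) => //= h; have := h isT.
Qed.

Lemma edgesP e :
  reflect (exists u v, adj u v /\ e = [set u; v]) (e \in edges G).
Proof.
rewrite inE; apply: (iffP existsP) => [[u /existsP[v /andP[uv /eqP ->]]]|].
  by exists u, v.
by move=> [u [v [uv ->]]]; exists u; apply/existsP; exists v; rewrite uv eqxx.
Qed.

Lemma edge_mem u v : adj u v -> [set u; v] \in edges G.
Proof. by move=> uv; apply/edgesP; exists u, v. Qed.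

Lemma in_C0 A : (A \in C0 G) = (A \subset edges G) && (odd_vertices A == finset.set0).
Proof. by rewrite inE powersetE. Qed.

Lemma in_C2 A : (A \in C2 G) = (A \subset edges G) && (#|odd_vertices A| == 2)%N.
Proof. by rewrite inE powersetE. Qed.

Lemma in_worm_space A : (A \in worm_space G) = (A \in C0 G) || (A \in C2 G).
Proof. by rewrite finset.in_setU. Qed.

Lemma C0_worm A : A \in C0 G -> A \in worm_space G.
Proof. by rewrite in_worm_space => ->. Qed.

Lemma worm_sub A : A \in worm_space G -> A \subset edges G.
Proof. by rewrite in_worm_space in_C0 in_C2 => /orP[]/andP[]. Qed.

Lemma set0_C0 : finset.set0 \in C0 G.
Proof. by rewrite in_C0 finset.sub0set odd_vertices0 /=. Qed.

Lemma endpoints_worm A u v : A \subset edges G -> odd_vertices A = endpoints u v ->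
  A \in worm_space G.
Proof.
move=> AE oA; rewrite in_worm_space in_C0 in_C2 AE oA /=.
have [<-|uv] := eqVneq u v; first by rewrite endpointsxx eqxx.
by rewrite endpointsE // cards2 uv orbT.
Qed.

(** This is [#|G|] on the even edge sets and 2 on those with two odd vertices,
    the two factors by which the stationary weights of the worm chain differ
    from [x ^+ #|A|]. *)
Definition num_ends A : nat :=
  #|[set p : G * G | odd_vertices A == endpoints p.1 p.2]|.

Lemma num_ends_C0 A : A \in C0 G -> num_ends A = #|G|.
Proof.
rewrite in_C0 => /andP[_ /eqP oA].
rewrite /num_ends -(@card_imset _ _ (fun u : G => (u, u))) => [|u v []//].
apply: eq_card => -[u v]; rewrite inE oA /=; apply/eqP/imsetP => /= [/setP /(_ u)|].
  by rewrite in_endpoints eqxx finset.in_set0 /= => /esym/negbFE/eqP ->; exists v.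
by move=> [w _ [-> ->]]; rewrite endpointsxx.
Qed.

Lemma num_ends_C2 A : A \in C2 G -> num_ends A = 2%N.
Proof.
rewrite in_C2 => /andP[_ /cards2P[u [v [uv oA]]]].
rewrite /num_ends oA (_ : [set p | _] = [set (u, v); (v, u)]); last first.
  apply/setP => -[a b]; rewrite !inE /=; apply/eqP/idP => [|/orP[]/eqP[-> ->]].
  - have [->|ab] := eqVneq a b.
      by rewrite endpointsxx => /setP/(_ u); rewrite !inE eqxx.
    rewrite endpointsE // => /(set2_orient uv)[] [-> ->]; by rewrite eqxx ?orbT.
  - by rewrite endpointsE.
  - by rewrite endpointsE 1?eq_sym // finset.setUC.
by rewrite cards2 xpair_eqE negb_and uv.
Qed.

Lemma num_ends_symdiff A F : F \in C0 G -> num_ends (symdiff A F) = num_ends A.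
Proof.
rewrite in_C0 => /andP[_ /eqP oF]; congr #|pred_of_set _|.
apply/setP => p; rewrite !inE; congr (_ == _); apply/setP => v.
by rewrite odd_vertices_symdiff oF finset.in_set0 addbF.
Qed.

Lemma symdiff_C0_worm A F :
  F \in C0 G -> (symdiff A F \in worm_space G) = (A \in worm_space G).
Proof.
move=> FC; have [FE /eqP oF] := andP (etrans (esym (in_C0 F)) FC).
suff h B : B \in worm_space G -> symdiff B F \in worm_space G.
  by apply/idP/idP => [/h|/h//]; rewrite symdiffK.
rewrite !in_worm_space !in_C0 !in_C2.
have -> : odd_vertices (symdiff B F) = odd_vertices B.
  by apply/setP => v; rewrite odd_vertices_symdiff oF finset.in_set0 addbF.
by case/orP=> /andP[BE ->]; rewrite symdiff_sub // ?orbT.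
Qed.

(** An edge at an odd vertex can be removed, as this moves the odd vertex to
    the other end of the edge; without odd vertices any edge will do. *)
Lemma worm_remove_edge D : D \in worm_space G -> D != finset.set0 ->
  exists2 e, e \in D & D :\ e \in worm_space G.
Proof.
move=> DW D0; have DE := worm_sub DW.
suff [u [v [w [uvD adj_uv oD]]]] : exists u v w,
    [/\ [set u; v] \in D, adj u v & odd_vertices D = endpoints u w].
  exists [set u; v] => //; rewrite -symdiffD1 //.
  apply: (@endpoints_worm _ v w).
    by rewrite symdiff_sub // finset.sub1set edge_mem.
  apply/setP => z; rewrite odd_vertices_symdiff1 oD -endpointsE ?adj_neq //.
  by rewrite !in_endpoints; case: (z == u); case: (z == v); case: (z == w).
move: DW; rewrite in_worm_space in_C0 in_C2 => /orP[/andP[_ /eqP oD]|/andP[_]].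
  have [e eD] := set0Pn _ D0.
  have [u [v [uv euv]]] := edgesP _ (fintype.subsetP DE e eD).
  by exists u, v, u; rewrite -euv eD uv oD endpointsxx.
move=> /cards2P[u [w [uw oD]]].
have : u \in odd_vertices D by rewrite oD !inE eqxx.
rewrite inE; case: (set_0Vmem [set e : {set G} in D | u \in e]) => [->|[e]].
  by rewrite cards0.
rewrite inE => /andP[eD ue] _.
have [a [b [ab eab]]] := edgesP _ (fintype.subsetP DE e eD).
move: ue; rewrite eab !inE => /orP[]/eqP ea; [exists a, b, w|exists b, a, w].
  by rewrite -eab eD ab oD -ea endpointsE.
by rewrite [[set b; a]]finset.setUC -eab eD adj_sym ab oD -ea endpointsE.
Qed.

End EdgeSets.

(** * The Ising susceptibility as a sum over subgraphs *)

Section Tanh.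
Variable R : realType.
Implicit Types b : R.

Lemma cosh2_gt0 b : 0 < expR b + expR (- b).
Proof. by rewrite addr_gt0 ?expR_gt0. Qed.

Lemma tanhR_gt0 b : 0 < b -> 0 < tanhR b.
Proof.
by move=> b0; rewrite divr_gt0 ?cosh2_gt0 // subr_gt0 ltr_expR; lra.
Qed.

Lemma tanhR_lt1 b : tanhR b < 1.
Proof.
by rewrite ltr_pdivrMr ?cosh2_gt0 // mul1r ltrD2l gtrN ?expR_gt0.
Qed.

Lemma expR_mul_sign b (s : bool) :
  expR (b * (-1) ^+ s) = (expR b + expR (- b)) / 2 * (1 + tanhR b * (-1) ^+ s).
Proof.
have c0 : expR b + expR (- b) != 0 by rewrite gt_eqF ?cosh2_gt0.
by rewrite /tanhR; case: s; rewrite ?expr1 ?expr0 ?mulr1 ?mulrN1; field.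
Qed.
End Tanh.

Section SubgraphSum.
Variables (R : realType) (G : sgraph).
Implicit Types (x beta : R) (A M : {set {set G}}) (S : {set G}).

Definition subgraph_sum x S : R :=
  \sum_(A : {set {set G}} | (A \subset edges G) && (odd_vertices A == S)) x ^+ #|A|.

Lemma sum_sign (k : nat) : \sum_(b : bool) (-1) ^+ b ^+ k = (if odd k then 0 else 2) :> R.
Proof.
rewrite big_bool /= expr1n expr1 -signr_odd.
by case: (odd k); rewrite ?expr1 ?expr0 ?addNr.
Qed.

Lemma sum_spin_prod A S :
  \sum_(s : {ffun G -> bool})
     (\prod_(e in A) \prod_(v in e) spin R s v) * \prod_(v in S) spin R s v
  = if odd_vertices A == S then 2 ^+ #|G| else 0.
Proof.
pose k v := (#|[set e : {set G} in A | v \in e]| + (v \in S))%N.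
have E s : (\prod_(e in A) \prod_(v in e) spin R s v) * \prod_(v in S) spin R s v
    = \prod_v (-1) ^+ s v ^+ k v.
  rewrite (exchange_big_dep xpredT) //= [X in _ * X]big_mkcond -big_split /=.
  apply: eq_bigr => v _; rewrite prodr_const exprD; congr (_ * _).
    by congr (_ ^+ _); apply: eq_card => e; rewrite !inE.
  by case: (v \in S).
rewrite (eq_bigr _ (fun s _ => E s)) -(bigA_distr_bigA (fun v (b : bool) => (-1) ^+ b ^+ k v)).
rewrite (eq_bigr _ (fun v _ => sum_sign (k v))).
have oddk v : odd (k v) = (v \in odd_vertices A) (+) (v \in S).
  by rewrite /k oddD oddb !inE.
have [/eqP AS|] := boolP (odd_vertices A == S).
  rewrite (eq_bigr (fun _ => 2)) ?prodr_const // => v _.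
  by rewrite oddk AS addbb.
apply: contraNeq => /prodf_neq0 h; apply/eqP/setP => v.
by have := h v isT; rewrite oddk; do 2! case: (_ \in _); rewrite ?eqxx.
Qed.

Lemma prod_edge_sign (s : {ffun G -> bool}) (e : {set G}) :
  exists b : bool, \prod_(v in e) spin R s v = (-1) ^+ b.
Proof.
exists (odd (\sum_(v in e) s v)); rewrite signr_odd -prodrXr.
by apply: eq_bigr.
Qed.

Lemma expR_mul_edge beta (s : {ffun G -> bool}) (e : {set G}) :
  expR (beta * \prod_(v in e) spin R s v)
  = (expR beta + expR (- beta)) / 2 * (1 + tanhR beta * \prod_(v in e) spin R s v).
Proof. by have [b ->] := prod_edge_sign s e; rewrite expR_mul_sign. Qed.

Lemma ising_weightE beta (s : {ffun G -> bool}) :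
  ising_weight beta s = ((expR beta + expR (- beta)) / 2) ^+ #|edges G| *
    \sum_(A : {set {set G}} | A \subset edges G)
       tanhR beta ^+ #|A| * \prod_(e in A) \prod_(v in e) spin R s v.
Proof.
rewrite /ising_weight mulr_sumr expR_sum.
under eq_bigr do rewrite expR_mul_edge.
rewrite big_split /= prodr_const; congr (_ * _).
rewrite big_mkcond.
pose F e := if e \in edges G then tanhR beta * \prod_(v in e) spin R s v else 0.
rewrite (eq_bigr (fun e => F e + 1)) => [|e _]; last first.
  by rewrite /F; case: ifP => _; rewrite ?add0r // addrC.
rewrite bigA_distr [RHS]big_mkcond; apply: eq_bigr => A _; rewrite -big_mkcond /=.
have [AE|] := boolP (A \subset edges G).
  rewrite (eq_bigr (fun e : {set G} => tanhR beta * \prod_(v in e) spin R s v)) => [|e eA].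
    by rewrite big_split /= prodr_const.
  by rewrite /F (fintype.subsetP AE).
by move=> /subsetPn[e eA /negPf eE]; rewrite (bigD1 e) //= /F eE mul0r.
Qed.

(** Expanding the product over the edges of the Boltzmann weight
    [cosh beta * (1 + tanh beta * spin u * spin v)] and summing over the spins
    leaves exactly the edge sets whose odd vertices are those of [S]. *)
Lemma high_temperature_expansion beta S :
  \sum_(s : {ffun G -> bool}) ising_weight beta s * \prod_(v in S) spin R s v
  = ((expR beta + expR (- beta)) / 2) ^+ #|edges G| * 2 ^+ #|G|
    * subgraph_sum (tanhR beta) S.
Proof.
under eq_bigr do rewrite ising_weightE -mulrA.
rewrite -mulr_sumr -mulrA; congr (_ * _).
under eq_bigr do rewrite mulr_suml.
rewrite exchange_big /= /subgraph_sum big_mkcondr mulr_sumr; apply: eq_bigr => A _.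
under eq_bigr do rewrite -mulrA.
by rewrite -mulr_sumr sum_spin_prod; case: ifP => _; rewrite ?mulr0 // mulrC.
Qed.

Lemma subgraph_sum0_ge1 x : 0 <= x -> 1 <= subgraph_sum x finset.set0.
Proof.
move=> x0; rewrite /subgraph_sum (bigD1 finset.set0) /=; last first.
  by rewrite finset.sub0set odd_vertices0 /=.
by rewrite cards0 expr0 lerDl; apply: sumr_ge0 => A _; rewrite exprn_ge0.
Qed.

(** By [high_temperature_expansion] both sides are, up to a common factor, sums of
    Ising weights, with signs on the left: spin correlations are at most one. *)
Lemma subgraph_sum_le0 beta S :
  subgraph_sum (tanhR beta) S <= subgraph_sum (tanhR beta) finset.set0.
Proof.
have c0 : 0 < ((expR beta + expR (- beta)) / 2) ^+ #|edges G| * 2 ^+ #|G| :> R.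
  by rewrite mulr_gt0 ?exprn_gt0 // divr_gt0 // cosh2_gt0.
rewrite -(ler_pM2l c0) -!high_temperature_expansion; apply: ler_sum => s _.
rewrite finset.big_set0 mulr1 ler_piMr ?expR_ge0 //.
have [b ->] := prod_edge_sign s S.
by case: b; rewrite ?expr1 ?expr0 // lerN10.
Qed.

Lemma ising_mean_prod beta S :
  ising_mean beta (fun s => \prod_(v in S) spin R s v)
  = subgraph_sum (tanhR beta) S / subgraph_sum (tanhR beta) finset.set0.
Proof.
have c0 : 0 < ((expR beta + expR (- beta)) / 2) ^+ #|edges G| * 2 ^+ #|G| :> R.
  by rewrite mulr_gt0 ?exprn_gt0 // divr_gt0 // cosh2_gt0.
rewrite /ising_mean /ising_prob.
under eq_bigr do rewrite mulrAC.
rewrite -mulr_suml high_temperature_expansion.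
have -> : \sum_(s : {ffun G -> bool}) ising_weight beta s =
    \sum_(s : {ffun G -> bool}) ising_weight beta s * \prod_(v in finset.set0) spin R s v.
  by apply: eq_bigr => s _; rewrite finset.big_set0 mulr1.
by rewrite high_temperature_expansion invfM mulrACA mulfV ?gt_eqF // mul1r.
Qed.

Lemma ising_weight_flip beta (s : {ffun G -> bool}) :
  ising_weight beta [ffun v => ~~ s v] = ising_weight beta s.
Proof.
congr (expR (_ * _)); apply: eq_bigr => e /edgesP[u [v [uv ->]]].
rewrite !big_setU1 ?inE ?adj_neq //= !big_set1 /spin !ffunE.
by case: (s u); case: (s v); rewrite ?expr1 ?expr0 ?mulrNN ?mulr1 ?mulrN1 ?opprK.
Qed.

Lemma ising_mean_magnetization beta : ising_mean beta (@magnetization R G) = 0.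
Proof.
pose flip (s : {ffun G -> bool}) := [ffun v => ~~ s v].
have flipK : involutive flip by move=> s; apply/ffunP => v; rewrite !ffunE negbK.
apply/eqP; rewrite -[_ == _](@mulrn_eq0 R _ 2) mulr2n {1}/ising_mean.
rewrite (reindex_inj (inv_inj flipK)) -big_split big1 //= => s _.
rewrite /ising_prob ising_weight_flip -mulrDr (_ : _ + _ = 0) ?mulr0 //.
rewrite /magnetization -big_split big1 //= => v _; rewrite /spin ffunE.
by case: (s v); rewrite ?expr1 ?expr0 ?subrr ?addNr.
Qed.

Lemma spinM (s : {ffun G -> bool}) u v :
  spin R s u * spin R s v = \prod_(z in endpoints u v) spin R s z.
Proof.
have [<-|uv] := eqVneq u v.
  by rewrite endpointsxx finset.big_set0 /spin -signr_addb addbb expr0.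
by rewrite endpointsE // big_setU1 ?inE //= big_set1.
Qed.

(** Also the normalizing constant of the stationary law of the worm chain, see
    [worm_weight_total]. *)
Definition susceptibility_sum x : R :=
  \sum_(u : G) \sum_(v : G) subgraph_sum x (endpoints u v).

Lemma susceptibilityE beta :
  susceptibility G beta = susceptibility_sum (tanhR beta)
    / (#|G|%:R * subgraph_sum (tanhR beta) finset.set0).
Proof.
rewrite /susceptibility /ising_var ising_mean_magnetization invfM mulrA mulrAC.
congr (_ / _); rewrite mulr_suml /ising_mean.
under [RHS]eq_bigr => u _ do rewrite mulr_suml.
under [RHS]eq_bigr => u _ do under eq_bigr => v _ do rewrite -ising_mean_prod.
rewrite /ising_mean; under [RHS]eq_bigr => u _ do rewrite exchange_big /=.
rewrite exchange_big /=; apply: eq_bigr => s _.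
rewrite subr0 expr2 /magnetization mulr_suml mulr_sumr; apply: eq_bigr => u _.
rewrite mulrA mulr_sumr.
by apply: eq_bigr => v _; rewrite -mulrA spinM.
Qed.

Lemma susceptibility_sum_le beta :
  susceptibility_sum (tanhR beta)
  <= #|G|%:R ^+ 2 * subgraph_sum (tanhR beta) finset.set0.
Proof.
apply: (@le_trans _ _ (\sum_(u : G) \sum_(v : G) subgraph_sum (tanhR beta) finset.set0)).
  by apply: ler_sum => u _; apply: ler_sum => v _; exact: subgraph_sum_le0.
have sum_cst (c : R) : \sum_(u : G) c = #|G|%:R * c by rewrite sumr_const mulr_natl.
by rewrite sum_cst sum_cst mulrA expr2 lexx.
Qed.
End SubgraphSum.

(** * The worm chain *)

Section WormChain.
Variables (R : realType) (G : sgraph) (x : R).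
Hypotheses (x_gt0 : 0 < x) (x_lt1 : x < 1).
Implicit Types (A B D F M : {set {set G}}) (e : {set G}) (u v z : G).
Implicit Types (a b : worm_state G).

(** The stationary weights of the worm chain. *)
Definition worm_weight A : R := (num_ends A)%:R * x ^+ #|A|.

Definition neighbour A B : bool :=
  [exists e : {set G}, (e \in edges G) && (B == symdiff A [set e])].

Lemma neighbourP A B :
  reflect (exists2 e, e \in edges G & B = symdiff A [set e]) (neighbour A B).
Proof.
apply: (iffP existsP) => [[e /andP[eE /eqP ->]]|[e eE ->]]; exists e => //.
by rewrite eE eqxx.
Qed.

Lemma neighbour_sym A B : neighbour A B = neighbour B A.
Proof.
by apply/neighbourP/neighbourP => -[e eE ->]; exists e; rewrite // symdiffK.
Qed.

Lemma card_setU_symdiff1 A e : #|A :|: symdiff A [set e]| = (#|A| + (e \notin A))%N.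
Proof.
have -> : A :|: symdiff A [set e] = e |: A.
  by apply/setP => f; rewrite !inE; case: (f \in A); case: (f == e).
by rewrite cardsU1 addnC.
Qed.

Lemma degree_gt0 u v : adj u v -> (0 < degree u)%N.
Proof. by move=> uv; apply/card_gt0P; exists v; rewrite inE. Qed.

Lemma degree_le_max u : (degree u <= max_degree G)%N.
Proof. exact: (leq_bigmax u). Qed.

Lemma inv_degree_ge u v : adj u v -> (max_degree G)%:R^-1 <= (degree u)%:R^-1 :> R.
Proof.
move=> uv; rewrite lef_pV2 ?posrE ?ltr0n ?ler_nat ?degree_le_max ?(degree_gt0 uv) //.
exact: leq_trans (degree_gt0 uv) (degree_le_max u).
Qed.

Lemma not_C0_C2 a : val a \notin C0 G -> val a \in C2 G.
Proof. by move=> /negPf a0; have := valP a; rewrite in_worm_space a0. Qed.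

Lemma card_vertex_gt0 u : (0 < #|G|)%N.
Proof. by apply/card_gt0P; exists u. Qed.

(** Counting the pairs of odd vertices with [num_ends] turns a weighted sum over
    the states into a double sum over the vertices. *)
Lemma worm_sum (g : {set {set G}} -> R) :
  \sum_(A in worm_space G) (num_ends A)%:R * g A
  = \sum_(u : G) \sum_(v : G)
      \sum_(A : {set {set G}} | (A \subset edges G) && (odd_vertices A == endpoints u v)) g A.
Proof.
rewrite pair_big /=; under [RHS]eq_bigr => p _ do rewrite big_mkcondr.
rewrite exchange_big /= [LHS]big_mkcond [RHS]big_mkcond; apply: eq_bigr => A _.
case: ifP => [AW|/negbT AW]; last first.
  case: ifP => // AE; rewrite big1 // => p _; case: ifP => // /eqP oA.
  by rewrite (endpoints_worm AE oA) in AW.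
rewrite (worm_sub AW) -big_mkcond /= sumr_const mulr_natl; congr (_ *+ _).
by rewrite /num_ends cardsE.
Qed.

Lemma worm_weight_total :
  \sum_(a : worm_state G) worm_weight (val a) = susceptibility_sum G x.
Proof. by rewrite -(big_sub _ worm_weight) /= worm_sum. Qed.

Lemma worm_weight_C0 :
  \sum_(a : worm_state G | val a \in C0 G) worm_weight (val a)
  = #|G|%:R * subgraph_sum x (finset.set0 : {set G}).
Proof.
rewrite -(big_sub_cond _ (fun A => A \in C0 G) worm_weight) /=.
rewrite (eq_bigl (fun A => A \in C0 G)) => [|A]; last first.
  by apply: andb_idl; exact: C0_worm.
rewrite mulr_sumr; apply: eq_big => [A|A A0]; first by rewrite in_C0.
by rewrite /worm_weight num_ends_C0.
Qed.

Lemma flow_from_C0 a b u v :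
  adj u v -> val b = symdiff (val a) [set [set u; v]] -> val a \in C0 G ->
  worm_weight (val a) * worm_transition x a b
  = x ^+ #|val a :|: val b| / 2 * ((degree u)%:R^-1 + (degree v)%:R^-1).
Proof.
move=> uv ab a0; rewrite (worm_transition_C0 _ uv ab a0) ab card_setU_symdiff1.
have n0 : #|G|%:R != 0 :> R by rewrite pnatr_eq0 -lt0n (card_vertex_gt0 u).
rewrite /worm_weight num_ends_C0 // exprD.
move: (#|G|%:R : R) n0 (x ^+ #|_|) (x ^+ (_ \notin _)) (_ + _) => n n0 p q s.
by field.
Qed.

Lemma flow_to_C0 a b u v :
  adj u v -> val b = symdiff (val a) [set [set u; v]] -> val b \in C0 G ->
  worm_weight (val a) * worm_transition x a b
  = x ^+ #|val a :|: val b| / 2 * ((degree u)%:R^-1 + (degree v)%:R^-1).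
Proof.
move=> uv ab b0; rewrite (worm_transition_toC0 _ uv ab b0) ab card_setU_symdiff1.
have a2 : val a \in C2 G.
  apply: not_C0_C2; apply/negP; rewrite in_C0 => /andP[_ /eqP oa].
  move: b0; rewrite in_C0 => /andP[_ /eqP/setP/(_ u)].
  by rewrite ab odd_vertices_symdiff1 oa !inE eqxx.
rewrite /worm_weight num_ends_C2 // exprD.
move: (x ^+ #|_|) (x ^+ (_ \notin _)) (_ + _) => p q s.
by field.
Qed.

Lemma expr_symdiff1 A e :
  x ^+ #|A| * x ^ ((e \notin A)%:Z - (e \in A)%:Z) = x ^+ #|symdiff A [set e]|.
Proof.
have [eA|eA] := boolP (e \in A).
  rewrite symdiffD1 // (cardsD1 e A) eA /= sub0r add1n exprS.
  by rewrite exprN1 mulrAC mulfV ?gt_eqF // mul1r.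
rewrite (_ : symdiff A [set e] = e |: A).
  by rewrite cardsU1 eA /= subr0 add1n exprS expr1z mulrC.
by apply/setP => f; rewrite in_symdiff !inE; have [->|_] := eqVneq f e;
  rewrite ?(negPf eA) ?addbF.
Qed.

Lemma flow_C2 a b u v :
  adj u v -> val b = symdiff (val a) [set [set u; v]] ->
  val a \in C2 G -> val b \in C2 G -> u \in odd_vertices (val a) ->
  worm_weight (val a) * worm_transition x a b
  = Num.min (x ^+ #|val b| / (degree v)%:R) (x ^+ #|val a| / (degree u)%:R) / 2.
Proof.
move=> uv ab a2 b2 ua; rewrite (worm_transition_C2 _ uv ab a2 b2 ua).
have du : 0 < (degree u)%:R :> R by rewrite ltr0n (degree_gt0 uv).
have dv : 0 < (degree v)%:R :> R by rewrite ltr0n (@degree_gt0 v u) // adj_sym.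
rewrite /worm_weight num_ends_C2 // ab -expr_symdiff1.
have p0 : 0 <= x ^+ #|val a| by rewrite exprn_ge0 // ltW.
move: (x ^ _) (x ^+ #|_|) p0 ((degree u)%:R : R) ((degree v)%:R : R) du dv => y p p0 d d' du dv.
have c0 : 0 <= p / d by rewrite divr_ge0 // ltW.
set m := Num.min _ 1.
have -> : 2 * p * (m * (1 / (4 * d))) = (p / d * m) / 2 by field; rewrite gt_eqF.
congr (_ / _); rewrite /m minr_pMr // mulr1; congr (Num.min _ _).
by field; rewrite !gt_eqF.
Qed.

Lemma odd_vertices_swap a b u v :
  adj u v -> val b = symdiff (val a) [set [set u; v]] ->
  val b \in C2 G -> u \in odd_vertices (val a) -> val a \in C2 G ->
  v \in odd_vertices (val b).
Proof.
move=> uv ab b2 ua a2; rewrite ab odd_vertices_symdiff1 !inE eqxx orbT addbT.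
apply/negP => va; have va' : v \in odd_vertices (val a) by rewrite inE.
move: a2; rewrite in_C2 => /andP[_ /eqP a2].
have oa : [set u; v] = odd_vertices (val a).
  apply/eqP; rewrite eqEcard a2 cards2 (adj_neq uv) andbT.
  by apply/fintype.subsetP => w; rewrite !inE => /orP[]/eqP ->; move: ua va'; rewrite !inE.
move: b2; rewrite in_C2 => /andP[_ /cards2P[w [w' [_ /setP/(_ w)]]]].
by rewrite ab odd_vertices_symdiff1 -oa addbb !inE eqxx.
Qed.

(** Every step flips an edge, and between states with two odd vertices the
    step is described from the end of the edge which is odd before it. *)
Lemma neighbour_edge a b : neighbour (val a) (val b) ->
  exists u v, [/\ adj u v, val b = symdiff (val a) [set [set u; v]] &
    val a \in C2 G -> val b \in C2 G ->
      (u \in odd_vertices (val a)) /\ (v \in odd_vertices (val b))].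
Proof.
move=> /neighbourP[e /edgesP[u [v [uv ->]]] ab].
have [a2|a2] := boolP (val a \in C2 G); last by exists u, v; split=> // /(negP a2).
have [b2|b2] := boolP (val b \in C2 G); last by exists u, v; split=> // _ /(negP b2).
have [ua|ua] := boolP (u \in odd_vertices (val a)).
  by exists u, v; split=> // _ _; split=> //; apply: odd_vertices_swap uv ab _ _ _.
have vu : adj v u by rewrite adj_sym.
have ab' : val b = symdiff (val a) [set [set v; u]] by rewrite [[set v; u]]finset.setUC.
suff va : v \in odd_vertices (val a).
  by exists v, u; split=> // _ _; split=> //; apply: odd_vertices_swap vu ab' _ _ _.
apply/negPn/negP => va; have := b2; rewrite in_C2 => /andP[_ /eqP b2'].
have : odd_vertices (val a) :|: [set u; v] \subset odd_vertices (val b).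
  apply/fintype.subsetP => w; rewrite ab odd_vertices_symdiff1 !finset.in_setU !finset.in_set1.
  have [->|_] := eqVneq w u; first by rewrite (negPf ua).
  by have [->|_] := eqVneq w v; rewrite ?(negPf va) //= orbF addbF.
move=> /subset_leq_card; rewrite b2' cardsU cards2 (adj_neq uv).
rewrite (_ : _ :&: _ = finset.set0) ?cards0; last first.
  apply/setP => w; rewrite !finset.in_setI !finset.in_setU !finset.in_set1 finset.in_set0.
  by apply/negP => /andP[wa /orP[]/eqP ww]; move: wa; rewrite ww ?(negPf ua) ?(negPf va).
by move: a2; rewrite in_C2 => /andP[_ /eqP ->].
Qed.

Lemma worm_transition_not_neighbour a b :
  a != b -> ~~ neighbour (val a) (val b) -> worm_transition x a b = 0.
Proof.
move=> ab nab; apply: worm_transition_eq0 => // u v uv bE.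
move/neighbourP: nab; apply; exists [set u; v] => //; exact: edge_mem.
Qed.

Lemma worm_detailed_balance a b :
  worm_weight (val a) * worm_transition x a b
  = worm_weight (val b) * worm_transition x b a.
Proof.
have [<-//|ab] := eqVneq a b.
have [nab|nab] := boolP (neighbour (val a) (val b)); last first.
  by rewrite !worm_transition_not_neighbour ?mulr0 // 1?neighbour_sym // eq_sym.
have [u [v [uv bE h]]] := neighbour_edge nab.
have aE : val a = symdiff (val b) [set [set u; v]] by rewrite bE symdiffK.
have [a0|a0] := boolP (val a \in C0 G).
  by rewrite (flow_from_C0 uv bE) // (flow_to_C0 uv aE) // [val a :|: _]finset.setUC.
have [b0|b0] := boolP (val b \in C0 G).
  by rewrite (flow_to_C0 uv bE) // (flow_from_C0 uv aE) // [val a :|: _]finset.setUC.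
have [a2 b2] := (not_C0_C2 a0, not_C0_C2 b0); have [ua vb] := h a2 b2.
have vu : adj v u by rewrite adj_sym.
have aE' : val a = symdiff (val b) [set [set v; u]] by rewrite [[set v; u]]finset.setUC.
by rewrite (flow_C2 uv bE) // (flow_C2 vu aE') // minC.
Qed.

Lemma worm_flow_ge a b : neighbour (val a) (val b) ->
  x ^+ #|val a :|: val b| / (2 * (max_degree G)%:R)
  <= worm_weight (val a) * worm_transition x a b.
Proof.
move=> /neighbour_edge[u [v [uv bE h]]].
have vu : adj v u by rewrite adj_sym.
set X := x ^+ _; have X0 : 0 <= X by rewrite exprn_ge0 // ltW.
have [du dv] := (inv_degree_ge uv, inv_degree_ge vu).
set D := (max_degree G)%:R in du dv *.
have D0 : 0 <= D^-1 by rewrite invr_ge0 ler0n.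
have [a0b0|] := boolP ((val a \in C0 G) || (val b \in C0 G)).
  have -> : worm_weight (val a) * worm_transition x a b
      = X / 2 * ((degree u)%:R^-1 + (degree v)%:R^-1).
    by case/orP: a0b0 => ?; [exact: flow_from_C0|exact: flow_to_C0].
  rewrite invfM mulrA ler_wpM2l ?divr_ge0 //.
  by apply: le_trans du _; rewrite lerDl; apply: le_trans dv.
rewrite negb_or => /andP[/not_C0_C2 a2 /not_C0_C2 b2]; have [ua vb] := h a2 b2.
rewrite (flow_C2 uv bE) // invfM mulrCA mulrC ler_wpM2r // le_min.
have XW A : A \subset val a :|: val b -> X <= x ^+ #|A|.
  by move=> /subset_leq_card; apply: ler_wiXn2l; exact: ltW.
by rewrite !ler_pM // XW ?finset.subsetUl ?finset.subsetUr.
Qed.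

Lemma worm_weight_ge0 A : 0 <= worm_weight A.
Proof. by rewrite mulr_ge0 // exprn_ge0 // ltW. Qed.

Lemma worm_weight_gt0 a : (0 < #|G|)%N -> 0 < worm_weight (val a).
Proof.
move=> G0; rewrite mulr_gt0 ?exprn_gt0 // ltr0n.
have := valP a; rewrite in_worm_space => /orP[/num_ends_C0|/num_ends_C2] -> //.
Qed.


(** A step can be seen as staying put with probability one half, and otherwise
    choosing a uniform odd vertex (any vertex if there is none), then one of its
    edges, which is flipped or not: the transition probabilities are then bounded
    by the chance to choose the edge. [move_mass a u] is the chance to
    choose [u]. *)
Definition move_mass a u : R :=
  if val a \in C0 G then (2 * #|G|%:R)^-1
  else if u \in odd_vertices (val a) then 4^-1 else 0.

Lemma move_mass_ge0 a u : 0 <= move_mass a u.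
Proof.
rewrite /move_mass; case: ifP => _; first by rewrite invr_ge0 mulr_ge0.
by case: ifP => _; rewrite ?invr_ge0.
Qed.

Lemma sum_move_mass a : (0 < #|G|)%N -> \sum_(u : G) move_mass a u = 2^-1.
Proof.
move=> G0; rewrite /move_mass; have [a0|/not_C0_C2] := boolP (val a \in C0 G).
  rewrite sumr_const -[LHS]mulr_natr invfM -mulrA mulVf ?mulr1 //.
  by rewrite pnatr_eq0 -lt0n.
rewrite in_C2 => /andP[_ /eqP a2]; rewrite -big_mkcond sumr_const /= a2.
by rewrite mulr2n; field.
Qed.

Definition directed_rate a b (p : G * G) : R :=
  if adj p.1 p.2 && (val b == symdiff (val a) [set [set p.1; p.2]])
  then move_mass a p.1 / (degree p.1)%:R else 0.

Lemma directed_rate_ge0 a b p : 0 <= directed_rate a b p.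
Proof. by rewrite /directed_rate; case: ifP => // _; rewrite divr_ge0 ?move_mass_ge0. Qed.

Lemma worm_offdiag_ge0 a b : 0 <= worm_offdiag x a b.
Proof.
rewrite /worm_offdiag; case: pickP => // -[u v] _.
have X k : 0 <= x ^+ k by rewrite exprn_ge0 // ltW.
rewrite /worm_rate; case: ifP => _; last case: ifP => _.
- by rewrite !mulr_ge0 ?addr_ge0 ?invr_ge0 ?mulr_ge0.
- by rewrite !mulr_ge0 ?addr_ge0 ?invr_ge0.
rewrite mulr_ge0 ?divr_ge0 ?mulr_ge0 // le_min ler01 andbT.
by rewrite mulr_ge0 ?divr_ge0 // exprz_ge0 // ltW.
Qed.

Lemma worm_offdiag_le a b : worm_offdiag x a b <= \sum_p directed_rate a b p.
Proof.
rewrite /worm_offdiag; case: pickP => [[u v]|_]; last first.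
  by apply: sumr_ge0 => p _; exact: directed_rate_ge0.
move=> /and3P[/= uv /eqP bE h].
have vu : adj v u by rewrite adj_sym.
have bE' : val b = symdiff (val a) [set [set v; u]] by rewrite [[set v; u]]finset.setUC.
have [nu nv] : (u, v) != (v, u) /\ (v, u) != (u, v).
  by rewrite !xpair_eqE [v == u]eq_sym !andbb (negPf (adj_neq uv)).
have t1 : directed_rate a b (u, v) = move_mass a u / (degree u)%:R.
  by rewrite /directed_rate /= uv bE eqxx.
have t2 : directed_rate a b (v, u) = move_mass a v / (degree v)%:R.
  by rewrite /directed_rate /= vu bE' eqxx.
have D w : 0 <= (degree w)%:R^-1 :> R by rewrite invr_ge0.
have X1 k : x ^+ k <= 1 by rewrite exprn_ile1 // ltW.
have both c : 0 <= c -> move_mass a u = c -> move_mass a v = c ->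
    x ^+ ([set u; v] \notin val a) * c * ((degree u)%:R^-1 + (degree v)%:R^-1)
    <= \sum_p directed_rate a b p.
  move=> c0 cu cv; rewrite (bigD1 (u, v)) // (bigD1 (v, u)) //= t1 t2 cu cv addrA -mulrDr.
  rewrite -[leLHS]addr0 lerD ?sumr_ge0 // => [|p _]; last exact: directed_rate_ge0.
  by rewrite ler_wpM2r ?addr_ge0 // ler_piMl.
rewrite /worm_rate; case: ifP => a0; last case: ifP => b0.
- by rewrite mul1r; apply: both; rewrite ?invr_ge0 ?mulr_ge0 // /move_mass a0.
- rewrite mul1r.
  have oa : odd_vertices (val a) = [set u; v].
    apply/setP => w; move: b0; rewrite in_C0 => /andP[_ /eqP/setP/(_ w)].
    rewrite odd_vertices_symdiff1 finset.in_set0.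
    by case: (w \in odd_vertices (val a)); case: (w \in [set u; v]).
  by apply: both; rewrite ?invr_ge0 // /move_mass a0 oa !inE eqxx ?orbT.
have a2 : val a \in C2 G by apply: not_C0_C2; rewrite a0.
have b2 : val b \in C2 G by apply: not_C0_C2; rewrite -[val b]/(sval b) bE b0.
rewrite (bigD1 (u, v)) //= t1 /move_mass a0; move: h; rewrite a2 b2 /= => -> /=.
rewrite -[leLHS]addr0 lerD ?sumr_ge0 // => [|p _]; last exact: directed_rate_ge0.
rewrite mul1r invfM ler_piMl ?mulr_ge0 ?invr_ge0 //.
by rewrite ge_min lexx orbT.
Qed.

Lemma worm_leave_le a : (0 < #|G|)%N ->
  \sum_(b : worm_state G | b != a) worm_offdiag x a b <= 2^-1.
Proof.
move=> G0; apply: (@le_trans _ _ (\sum_(b : worm_state G) \sum_p directed_rate a b p)).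
  rewrite big_mkcond; apply: ler_sum => b _; case: ifP => _; first exact: worm_offdiag_le.
  by apply: sumr_ge0 => p _; exact: directed_rate_ge0.
rewrite exchange_big /= -(sum_move_mass a G0).
apply: (@le_trans _ _ (\sum_(p : G * G | adj p.1 p.2) move_mass a p.1 / (degree p.1)%:R)).
  rewrite [leRHS]big_mkcond; apply: ler_sum => p _; rewrite /directed_rate.
  case: ifP => _ /=; last by rewrite big1.
  case: (pickP (fun b : worm_state G => val b == symdiff (val a) [set [set p.1; p.2]])).
    move=> b /eqP bE; rewrite (bigD1 b) //= bE eqxx big1 ?addr0 // => c cb.
    by rewrite -bE (inj_eq val_inj) (negPf cb).
  by move=> h; rewrite big1 => [|b _]; rewrite ?h // divr_ge0 ?move_mass_ge0.
rewrite -(pair_big_dep xpredT (@adj G) (fun u v => move_mass a u / (degree u)%:R)) /=.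
apply: ler_sum => u _; rewrite sumr_const.
have -> : #|(adj u : pred G)| = degree u by rewrite /degree cardsE.
have [->|d0] := eqVneq (degree u) 0%N; first by rewrite mulr0n move_mass_ge0.
by rewrite -[leLHS]mulr_natr divfK // pnatr_eq0.
Qed.

Lemma worm_transition_ge0 a b : a != b -> 0 <= worm_transition x a b.
Proof. by rewrite /worm_transition => /negPf ->; exact: worm_offdiag_ge0. Qed.

Lemma worm_lazy a : (0 < #|G|)%N -> 2^-1 <= worm_transition x a a.
Proof.
by move=> G0; rewrite /worm_transition eqxx; have := worm_leave_le a G0; lra.
Qed.

(** Every state has at most [#|G|] pairs of ends, and there are at most
    [2 ^ #|edges G|] states. *)
Lemma worm_weight_total_le : (1 < #|G|)%N ->
  susceptibility_sum G x <= 2 ^+ #|edges G| * worm_weight finset.set0.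
Proof.
move=> G1; rewrite -worm_weight_total -(big_sub _ worm_weight) /=.
rewrite /worm_weight (num_ends_C0 (set0_C0 G)) cards0 expr0 mulr1.
apply: (@le_trans _ _ (\sum_(A in powerset (edges G)) #|G|%:R)).
  rewrite [leLHS]big_mkcond [leRHS]big_mkcond; apply: ler_sum => A _.
  case: ifP => [AW|_]; last by case: ifP.
  rewrite powersetE (worm_sub AW) -[leRHS]mulr1 ler_pM ?exprn_ge0 //.
  - exact: ltW.
  - move: AW; rewrite ler_nat in_worm_space => /orP[/num_ends_C0|/num_ends_C2] -> //.
  - by rewrite exprn_ile1 // ltW.
by rewrite sumr_const card_powerset -[leLHS]mulr_natl natrX.
Qed.

End WormChain.

(** * Canonical paths and the Poincare inequality *)

Lemma sqr_sum_le (R : realType) (m : nat) (a : nat -> R) :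
  (\sum_(i < m) a i) ^+ 2 <= m%:R * \sum_(i < m) a i ^+ 2.
Proof.
set S := \sum_(i < m) a i; set Q := \sum_(i < m) a i ^+ 2.
have inner i : \sum_(j < m) (a i - a j) ^+ 2 = m%:R * a i ^+ 2 - 2 * S * a i + Q.
  under eq_bigr do rewrite sqrrB.
  rewrite big_split sumrB /= sumr_const card_ord sumrMnl -mulr_sumr -/S -/Q.
  by rewrite -[_ *+ m]mulr_natl -mulr_natl; ring.
have : 0 <= \sum_(i < m) \sum_(j < m) (a i - a j) ^+ 2.
  by apply: sumr_ge0 => i _; apply: sumr_ge0 => j _; exact: sqr_ge0.
under eq_bigr do rewrite inner.
rewrite big_split sumrB /= sumr_const card_ord -!mulr_sumr -/S -/Q -[Q *+ m]mulr_natl.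
by move: (m%:R * Q) => mQ; nra.
Qed.

Section CanonicalPaths.
Variables (R : realType) (G : sgraph) (x : R).
Hypotheses (x_gt0 : 0 < x) (x_lt1 : x < 1).
Hypothesis subgraph_sum_max : forall S : {set G},
  subgraph_sum x S <= subgraph_sum x (finset.set0 : {set G}).
Implicit Types (A B D F M : {set {set G}}) (e : {set G}) (u v z : G).
Implicit Types (a b : worm_state G) (g : {set {set G}} -> R).

(** With [D] the difference of a state [I] and an even edge set [F], the path from
    [I] to [F] visits the differences of [F] with [D], [remove_edge D],
    [remove_edge (remove_edge D)] and so on until the empty set. *)
Definition remove_edge D : {set {set G}} :=
  if [pick e in D | D :\ e \in worm_space G] is Some e then D :\ e else D.

Lemma remove_edgeP D : D \in worm_space G ->
  (D = finset.set0 /\ remove_edge D = D) \/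
  exists e, [/\ e \in D, remove_edge D = symdiff D [set e] & remove_edge D \in worm_space G].
Proof.
move=> DW; rewrite /remove_edge; case: pickP => [e /andP[eD DeW]|h].
  by right; exists e; rewrite symdiffD1.
left; split=> //; apply/eqP/negPn/negP => D0.
by have [e eD DeW] := worm_remove_edge DW D0; have := h e; rewrite eD DeW.
Qed.

Definition strip (i : nat) D : {set {set G}} := iter i remove_edge D.

Lemma strip_worm i D : D \in worm_space G -> strip i D \in worm_space G.
Proof.
move=> DW; elim: i => [//|i IH] /=.
by have [[_ ->]|[e []]] := remove_edgeP IH.
Qed.

Lemma strip_sub i D : D \in worm_space G -> strip i D \subset D.
Proof.
move=> DW; elim: i => [//|i IH] /=; rewrite -/(strip _ _).
have [[_ ->]//|[e [eD -> _]]] := remove_edgeP (strip_worm i DW).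
by rewrite symdiffD1 //; apply: fintype.subset_trans IH; exact: subD1set.
Qed.

Lemma strip_card i D : D \in worm_space G -> #|strip i D| = (#|D| - i)%N.
Proof.
move=> DW; elim: i => [|i IH] /=; first by rewrite subn0.
rewrite -/(strip _ _) subnS -IH.
have [[h ->]|[e [eD -> _]]] := remove_edgeP (strip_worm i DW); first by rewrite h cards0.
by rewrite symdiffD1 // (cardsD1 e (strip i D)) eD.
Qed.

Lemma strip_edges D : D \in worm_space G -> strip #|edges G| D = finset.set0.
Proof.
move=> DW; apply: cards0_eq; apply/eqP.
by rewrite strip_card // subn_eq0 subset_leq_card // worm_sub.
Qed.

(** The Dirichlet form with the flow through each step replaced by
    [x ^+ #|A :|: B|], to which it is comparable by [worm_flow_ge]; [k] is a
    congestion, as a function of the larger state of the step. *)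
Definition edge_energy (k : {set {set G}} -> R) g : R :=
  \sum_(A in worm_space G) \sum_(B in worm_space G | neighbour A B)
    x ^+ #|A :|: B| * k (A :|: B) * (g A - g B) ^+ 2.

(** The [i]-th steps of the paths with difference [D]. Such a step determines
    [F], as its first state is the difference of [F] and [strip i D]. If [M] is
    the larger of its two states, then [M] and [F] agree outside [D], so that the
    weight of the pair is that of [M] and [symdiff M D]. *)
Lemma path_step_le D i g : D \in worm_space G ->
  \sum_(F in C0 G) x ^+ (#|F| + #|symdiff F D|)
    * (g (symdiff F (strip i D)) - g (symdiff F (strip i.+1 D))) ^+ 2
  <= edge_energy (fun M => x ^+ #|symdiff M D|) g.
Proof.
move=> DW; have X k : 0 <= x ^+ k by rewrite exprn_ge0 // ltW.
have term0 A B : 0 <= x ^+ #|A :|: B| * x ^+ #|symdiff (A :|: B) D| * (g A - g B) ^+ 2.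
  by rewrite mulr_ge0 ?sqr_ge0 // mulr_ge0.
have [Di0|[e [eD stripS DeW]]] := remove_edgeP (strip_worm i DW).
  rewrite big1 => [|F _]; last by rewrite /= -/(strip _ _) Di0.2 subrr expr0n mulr0.
  by apply: sumr_ge0 => A _; apply: sumr_ge0 => B _.
have eE : e \in edges G.
  by apply: (fintype.subsetP (worm_sub DW)); exact: (fintype.subsetP (strip_sub i DW)).
rewrite (eq_bigr (fun F => let A := symdiff F (strip i D) in let B := symdiff A [set e] in
    x ^+ #|A :|: B| * x ^+ #|symdiff (A :|: B) D| * (g A - g B) ^+ 2)); last first.
  move=> F _ /=; rewrite -/(strip i D) stripS -symdiffA -exprD.
  set M := _ :|: _; rewrite (card_symdiff_const (_ : symdiff M F \subset D)) //.
  apply/fintype.subsetP => f; rewrite in_symdiff finset.in_setU !in_symdiff.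
  have := fintype.subsetP (strip_sub i DW) f; rewrite finset.in_set1.
  case: eqP => [-> _|_]; last by case: (f \in F); case: (f \in strip i D) => // h _; exact: h.
  by move=> _; exact: (fintype.subsetP (strip_sub i DW)).
rewrite (reindex_inj (inv_inj (symdiffK (strip i D)))) /=.
rewrite /edge_energy [leLHS]big_mkcond [leRHS]big_mkcond; apply: ler_sum => A _.
rewrite symdiffK; case: ifP => [AC|_]; last by case: ifP => // _; apply: sumr_ge0.
have AE : A = symdiff (strip i D) (symdiff A (strip i D)).
  by rewrite [symdiff A _]symdiffC symdiffA symdiffxx symdiffC symdiff0.
have AW : A \in worm_space G by rewrite AE symdiff_C0_worm // strip_worm.
have BW : symdiff A [set e] \in worm_space G.
  by rewrite AE -symdiffA [symdiff _ [set e]]symdiffC symdiffA -stripS symdiff_C0_worm.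
rewrite AW (bigD1 (symdiff A [set e])) /=; last first.
  by rewrite BW; apply/neighbourP; exists e.
by rewrite lerDl sumr_ge0.
Qed.

(** Cauchy-Schwarz along the paths, which have at most [#|edges G|] steps; the
    second factor [#|edges G|] comes from summing [path_step_le] over [i]. *)
Lemma path_le D g : D \in worm_space G ->
  \sum_(F in C0 G) x ^+ (#|F| + #|symdiff F D|) * (g (symdiff F D) - g F) ^+ 2
  <= #|edges G|%:R ^+ 2 * edge_energy (fun M => x ^+ #|symdiff M D|) g.
Proof.
move=> DW; have X k : 0 <= x ^+ k by rewrite exprn_ge0 // ltW.
set m := #|edges G|.
pose d F i := g (symdiff F (strip i D)) - g (symdiff F (strip i.+1 D)).
have dE F : g (symdiff F D) - g F = \sum_(i < m) d F i.
  rewrite -(big_mkord xpredT) /d.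
  under eq_bigr do rewrite -opprB.
  rewrite sumrN telescope_sumr // strip_edges // symdiff0 opprB //.
apply: (@le_trans _ _ (\sum_(F in C0 G) x ^+ (#|F| + #|symdiff F D|) *
    (m%:R * \sum_(i < m) d F i ^+ 2))).
  by apply: ler_sum => F _; rewrite dE ler_wpM2l // sqr_sum_le.
under eq_bigr do rewrite mulrCA mulr_sumr.
rewrite -mulr_sumr exchange_big /= expr2 -mulrA ler_wpM2l //.
apply: (@le_trans _ _ (\sum_(i < m) edge_energy (fun M => x ^+ #|symdiff M D|) g)).
  by apply: ler_sum => i _; exact: path_step_le.
by rewrite sumr_const card_ord mulr_natl.
Qed.

Lemma edge_energy_sum (K : {set {set G}} -> R) (k : {set {set G}} -> {set {set G}} -> R) g :
  \sum_(D in worm_space G) K D * edge_energy (k D) g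
  = edge_energy (fun M => \sum_(D in worm_space G) K D * k D M) g.
Proof.
under eq_bigr do rewrite mulr_sumr.
rewrite exchange_big; apply: eq_bigr => A _ /=.
under eq_bigr do rewrite mulr_sumr.
rewrite exchange_big; apply: eq_bigr => B _ /=.
rewrite mulr_sumr mulr_suml; apply: eq_bigr => D _.
by rewrite -!mulrA mulrCA.
Qed.

(** The sum is over the edge sets [symdiff M D], whose odd vertices are those of
    [M] up to a pair [(u, v)]: one spin correlation for each pair. *)
Lemma encoding_sum_le M : M \subset edges G ->
  \sum_(D in worm_space G) (num_ends D)%:R * x ^+ #|symdiff M D|
  <= #|G|%:R ^+ 2 * subgraph_sum x (finset.set0 : {set G}).
Proof.
move=> ME; rewrite (worm_sum (fun D => x ^+ #|symdiff M D|)).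
have sum_cst (c : R) : \sum_(u : G) c = #|G|%:R * c by rewrite sumr_const mulr_natl.
apply: (@le_trans _ _ (\sum_(u : G) \sum_(v : G) subgraph_sum x (finset.set0 : {set G}))).
  apply: ler_sum => u _; apply: ler_sum => v _.
  pose S : {set G} := [set z | (z \in odd_vertices M) (+) (z \in endpoints u v)].
  have inS z : (z \in S) = (z \in odd_vertices M) (+) (z \in endpoints u v).
    by rewrite finset.in_set.
  apply: le_trans (subgraph_sum_max S).
  rewrite (reindex_inj (inv_inj (symdiffK M))) /=.
  rewrite /subgraph_sum; rewrite le_eqVlt; apply/orP; left; apply/eqP; apply: eq_big => [A|A _].
    have -> : (symdiff A M \subset edges G) = (A \subset edges G).
      by apply/idP/idP => h; [rewrite -(symdiffK M A)|]; exact: symdiff_sub.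
    congr (_ && _); apply/eqP/eqP => [h|h]; apply/setP => z.
      by rewrite inS -h odd_vertices_symdiff addbC addbK.
    by rewrite odd_vertices_symdiff h inS addbC addKb.
  by rewrite symdiffC symdiffK.
by rewrite sum_cst sum_cst mulrA expr2.
Qed.

Lemma edge_energy_le (k : {set {set G}} -> R) c g :
  (forall M, M \subset edges G -> k M <= c) ->
  edge_energy k g <= c * edge_energy (fun=> 1) g.
Proof.
move=> kc; rewrite /edge_energy mulr_sumr; apply: ler_sum => A AW; rewrite mulr_sumr.
apply: ler_sum => B /andP[BW _]; rewrite mulr1 mulrAC mulrC ler_wpM2r //.
  by rewrite mulr_ge0 ?sqr_ge0 // exprn_ge0 // ltW.
by apply: kc; rewrite finset.subUset !worm_sub.
Qed.

Lemma worm_path_bound g :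
  \sum_(A in worm_space G) \sum_(F in C0 G)
     worm_weight x A * x ^+ #|F| * (g A - g F) ^+ 2
  <= #|edges G|%:R ^+ 2 * #|G|%:R ^+ 2 * subgraph_sum x (finset.set0 : {set G})
     * edge_energy (fun=> 1) g.
Proof.
have -> : \sum_(A in worm_space G) \sum_(F in C0 G)
      worm_weight x A * x ^+ #|F| * (g A - g F) ^+ 2
    = \sum_(D in worm_space G) (num_ends D)%:R *
      \sum_(F in C0 G) x ^+ (#|F| + #|symdiff F D|) * (g (symdiff F D) - g F) ^+ 2.
  under [RHS]eq_bigr do rewrite mulr_sumr.
  rewrite exchange_big [RHS]exchange_big /=; apply: eq_bigr => F FC.
  rewrite [LHS](reindex_inj (inv_inj (symdiffK F))) /=.
  apply: eq_big => [D|D _]; first exact: symdiff_C0_worm.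
  rewrite /worm_weight num_ends_symdiff // [symdiff F D]symdiffC exprD.
  by rewrite -!mulrA; congr (_ * _); rewrite mulrCA.
apply: (@le_trans _ _ (\sum_(D in worm_space G) (num_ends D)%:R *
    (#|edges G|%:R ^+ 2 * edge_energy (fun M => x ^+ #|symdiff M D|) g))).
  by apply: ler_sum => D DW; rewrite ler_wpM2l // path_le.
under eq_bigr do rewrite mulrCA.
rewrite -mulr_sumr edge_energy_sum.
have := encoding_sum_le; have := sqr_ge0 (#|edges G|%:R : R).
move: (#|edges G|%:R ^+ 2 : R) (#|G|%:R ^+ 2 : R) => m2 n2 m0 enc.
rewrite -(mulrA m2 n2) -(mulrA m2).
by rewrite ler_wpM2l // edge_energy_le.
Qed.

Lemma edge_energy_flow g : (0 < max_degree G)%N ->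
  edge_energy (fun=> 1) g <= 2 * (max_degree G)%:R *
    \sum_(a : worm_state G) \sum_(b : worm_state G)
      worm_weight x (val a) * worm_transition x a b * (g (val a) - g (val b)) ^+ 2.
Proof.
move=> D0; rewrite /edge_energy big_sub mulr_sumr; apply: ler_sum => a _.
rewrite big_sub_cond mulr_sumr big_mkcond; apply: ler_sum => b _; case: ifP => [nab|_].
  rewrite mulr1 mulrA ler_wpM2r ?sqr_ge0 // mulrC -ler_pdivrMr ?worm_flow_ge //.
  by rewrite mulr_gt0 // ltr0n.
have [->|ab] := eqVneq a b; first by rewrite subrr expr0n !mulr0.
apply: mulr_ge0; first exact: mulr_ge0.
apply: mulr_ge0; last exact: sqr_ge0.
by rewrite mulr_ge0 ?worm_weight_ge0 ?worm_transition_ge0.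
Qed.

(** The Poincare inequality of the worm chain. A function of mean zero has a
    smaller second moment than its difference with any constant, in particular
    with its value at a random even edge set [F] of weight [x ^+ #|F|], and
    [worm_path_bound] compares with that value along the paths. *)
Lemma worm_poincare (f : worm_state G -> R) : (0 < max_degree G)%N ->
  \sum_(a : worm_state G) worm_weight x (val a) * f a = 0 ->
  \sum_(a : worm_state G) worm_weight x (val a) * f a ^+ 2
  <= 2 * (max_degree G)%:R * #|edges G|%:R ^+ 2 * #|G|%:R ^+ 2 *
    \sum_(a : worm_state G) \sum_(b : worm_state G)
      worm_weight x (val a) * worm_transition x a b * (f a - f b) ^+ 2.
Proof.
move=> D0 f0.
pose g A := if insub A is Some a then f a else 0.
have gE a : g (val a) = f a by rewrite /g valK.
have Z0 : 0 < subgraph_sum x (finset.set0 : {set G}).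
  by apply: lt_le_trans (subgraph_sum0_ge1 _ (ltW x_gt0)).
rewrite -(ler_pM2l Z0).
have pb := worm_path_bound g; have ef := edge_energy_flow g D0.
apply: le_trans (le_trans pb _); last first.
  have -> : \sum_(a : worm_state G) \sum_(b : worm_state G)
      worm_weight x (val a) * worm_transition x a b * (f a - f b) ^+ 2 =
    \sum_(a : worm_state G) \sum_(b : worm_state G)
      worm_weight x (val a) * worm_transition x a b * (g (val a) - g (val b)) ^+ 2.
    by apply: eq_bigr => a _; apply: eq_bigr => b _; rewrite !gE.
  apply: le_trans (ler_wpM2l _ ef) _; last first.
    by rewrite le_eqVlt; apply/orP; left; apply/eqP; ring.
  by rewrite !mulr_ge0 ?sqr_ge0 // ltW.
rewrite exchange_big /= /subgraph_sum mulr_suml.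
rewrite [leRHS](eq_bigl
  (fun F => (F \subset edges G) && (odd_vertices F == finset.set0))); last first.
  by move=> F; rewrite in_C0.
apply: ler_sum => F _; rewrite [leRHS]big_sub mulr_sumr.
have -> : \sum_(a : worm_state G)
      worm_weight x (val a) * x ^+ #|F| * (g (val a) - g F) ^+ 2
    = \sum_(a : worm_state G) x ^+ #|F| * (worm_weight x (val a) * f a ^+ 2)
      - 2 * x ^+ #|F| * g F * (\sum_(a : worm_state G) worm_weight x (val a) * f a)
      + \sum_(a : worm_state G) x ^+ #|F| * g F ^+ 2 * worm_weight x (val a).
  rewrite mulr_sumr -sumrB -big_split /=; apply: eq_bigr => a _; rewrite gE.
  by move: (worm_weight x (val a)) (x ^+ #|F|) (f a) (g F) => *; ring.
rewrite f0 mulr0 subr0 lerDl sumr_ge0 // => a _.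
by rewrite mulr_ge0 ?worm_weight_ge0 // mulr_ge0 ?sqr_ge0 // exprn_ge0 // ltW.
Qed.

End CanonicalPaths.

(** * Sampling a lazy reversible Markov chain *)

Section LazyChain.
Variables (R : realType) (S : finType) (p : S -> S -> R) (w : S -> R) (T : R).
Hypotheses (p_ge0 : forall a b, 0 <= p a b) (p_sum1 : forall a, \sum_b p a b = 1).
Hypotheses (w_ge0 : forall a, 0 <= w a) (w_sum1 : \sum_a w a = 1).
Hypothesis reversible : forall a b, w a * p a b = w b * p b a.
Hypothesis lazy : forall a, 2^-1 <= p a a.
Hypothesis T_gt1 : 1 < T.

Definition mean (f : S -> R) : R := \sum_a w a * f a.
Definition dot (f g : S -> R) : R := \sum_a w a * (f a * g a).
Definition step (f : S -> R) (a : S) : R := \sum_b p a b * f b.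

Hypothesis poincare : forall f, mean f = 0 ->
  dot f f <= T / 2 * \sum_a \sum_b w a * p a b * (f a - f b) ^+ 2.

Definition rate : R := 1 - T^-1.

Lemma rate_gt0 : 0 < rate.
Proof. by rewrite subr_gt0 invf_lt1 // (lt_trans ltr01). Qed.

Lemma rate_mulT : rate * T = T - 1.
Proof. by rewrite mulrBl mul1r mulVf // gt_eqF // (lt_trans ltr01). Qed.

Lemma meanD f g : mean (fun a => f a + g a) = mean f + mean g.
Proof. by rewrite -big_split; apply: eq_bigr => a _; rewrite mulrDr. Qed.

Lemma meanZ c f : mean (fun a => c * f a) = c * mean f.
Proof. by rewrite mulr_sumr; apply: eq_bigr => a _; rewrite mulrCA. Qed.

Lemma mean_cst c : mean (fun=> c) = c.
Proof. by rewrite /mean -mulr_suml w_sum1 mul1r. Qed.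

Lemma ler_mean f g : (forall a, f a <= g a) -> mean f <= mean g.
Proof. by move=> fg; apply: ler_sum => a _; rewrite ler_wpM2l. Qed.

Lemma dotC f g : dot f g = dot g f.
Proof. by apply: eq_bigr => a _; rewrite [f a * _]mulrC. Qed.

Lemma dot_ge0 f : 0 <= dot f f.
Proof. by apply: sumr_ge0 => a _; rewrite mulr_ge0 // -expr2 sqr_ge0. Qed.

Lemma dotDr f g h : dot f (fun a => g a + h a) = dot f g + dot f h.
Proof. by rewrite -big_split; apply: eq_bigr => a _; rewrite !mulrDr. Qed.

Lemma dot_combine c f g h : dot f (fun a => c * g a - h a) = c * dot f g - dot f h.
Proof.
rewrite /dot mulr_sumr -sumrB; apply: eq_bigr => a _.
by move: (w a) (f a) (g a) (h a) => *; ring.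
Qed.

Lemma dot_combinel c f g h : dot (fun a => c * g a - h a) f = c * dot g f - dot h f.
Proof. by rewrite dotC dot_combine dotC [dot f h]dotC. Qed.

Lemma step_combine c f g a : step (fun b => c * f b - g b) a = c * step f a - step g a.
Proof.
by rewrite /step mulr_sumr -sumrB; apply: eq_bigr => b _; rewrite mulrBr mulrCA.
Qed.

Lemma ler_step f g a : (forall b, f b <= g b) -> step f a <= step g a.
Proof. by move=> fg; apply: ler_sum => b _; rewrite ler_wpM2l. Qed.

Lemma step_cst c a : step (fun=> c) a = c.
Proof. by rewrite /step -mulr_suml p_sum1 mul1r. Qed.

Lemma stationary b : \sum_a w a * p a b = w b.
Proof.
by under eq_bigr do rewrite reversible; rewrite -mulr_sumr p_sum1 mulr1.
Qed.

Lemma mean_step f : mean (step f) = mean f.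
Proof.
rewrite /mean /step; under eq_bigr do rewrite mulr_sumr.
rewrite exchange_big /=; apply: eq_bigr => b _; rewrite -[in RHS]stationary mulr_suml.
by apply: eq_bigr => a _; rewrite mulrA.
Qed.

Lemma dot_stepE f g : dot f (step g) = \sum_a \sum_b w a * p a b * (f a * g b).
Proof.
apply: eq_bigr => a _; rewrite /step mulr_sumr mulr_sumr; apply: eq_bigr => b _.
by move: (w a) (p a b) (f a) (g b) => *; ring.
Qed.

Lemma dot_step_sym f g : dot f (step g) = dot (step f) g.
Proof.
rewrite [RHS]dotC !dot_stepE exchange_big /=; apply: eq_bigr => a _.
by apply: eq_bigr => b _; rewrite reversible [f b * _]mulrC.
Qed.

Lemma sum_flow_sqr c f : c ^+ 2 = 1 ->
  \sum_a \sum_b w a * p a b * (f a + c * f b) ^+ 2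
  = 2 * (dot f f + c * dot f (step f)).
Proof.
move=> c2; have l : \sum_a \sum_b w a * p a b * (f a * f a) = dot f f.
  by apply: eq_bigr => a _; rewrite -mulr_suml -mulr_sumr p_sum1 mulr1.
have r : \sum_a \sum_b w a * p a b * (f b * f b) = dot f f.
  by rewrite exchange_big /=; apply: eq_bigr => b _; rewrite -mulr_suml stationary.
rewrite mulrDr mulr2n mulrDl mul1r -{1}l -r dot_stepE !mulr_sumr -!big_split /=.
apply: eq_bigr => a _; rewrite !mulr_sumr -!big_split /=; apply: eq_bigr => b _.
rewrite sqrrD exprMn c2; move: (w a) (p a b) (f a) (f b) => *; ring.
Qed.

(** The diagonal terms alone make the sum of the [w a * p a b * (f a + f b) ^+ 2]
    at least [2 * dot f f]. *)
Lemma dot_step_ge0 f : 0 <= dot f (step f).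
Proof.
have := sum_flow_sqr f (expr1n R 2); rewrite mul1r => E.
suff : 2 * dot f f <= \sum_a \sum_b w a * p a b * (f a + 1 * f b) ^+ 2.
  by rewrite E; move: (dot f f) (dot f _) => *; lra.
rewrite mulr_sumr; apply: ler_sum => a _; rewrite (bigD1 a) //= -[leLHS]addr0 lerD //.
  rewrite mul1r mulrCA -[leRHS]mulrA ler_wpM2l //.
  have := lazy a; have := sqr_ge0 (f a); move: (p a a) (f a) => q y ? ?.
  have -> : (y + y) ^+ 2 = 4 * (y * y) by ring.
  by rewrite -expr2; nra.
by apply: sumr_ge0 => b _; rewrite mulr_ge0 ?sqr_ge0 // mulr_ge0.
Qed.

Lemma dot_step_le f : mean f = 0 -> dot f (step f) <= rate * dot f f.
Proof.
move=> /poincare.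
have E := sum_flow_sqr f (_ : (-1) ^+ 2 = 1); rewrite sqrrN expr1n in E.
have {E} := E erefl.
under eq_bigr do under eq_bigr do rewrite mulN1r.
move=> -> h; have T0 : 0 < T by apply: lt_trans T_gt1.
move: h; move: (dot f f) (dot f (step f)) => n d h.
rewrite -(ler_pM2l T0) mulrA [T * rate]mulrC rate_mulT.
have {h} : n <= T * n - T * d.
  by apply: le_trans h _; rewrite le_eqVlt; apply/orP; left; apply/eqP; field.
by rewrite mulrBl mul1r; move: (T * n) (T * d) => *; lra.
Qed.

(** As the chain is positive, [dot_step_le] also bounds the norm of [step f]:
    expand the positivity of the chain at [rate * f - step f]. *)
Lemma dot_step_step_le f : mean f = 0 ->
  dot (step f) (step f) <= rate ^+ 2 * dot f f.
Proof.
move=> f0; pose u a := rate * f a - step f a.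
have step_u : step u = fun a => rate * step f a - step (step f) a.
  by apply/funext => a; rewrite /u step_combine.
have := dot_step_ge0 u; rewrite step_u dot_combine !dot_combinel.
rewrite [dot f (step (step f))]dot_step_sym.
have := dot_step_le f0; have := @dot_step_le (step f); rewrite mean_step => /(_ f0).
move: rate rate_gt0 (dot f f) (dot f (step f)) (dot (step f) (step f)) (dot (step f) _).
move=> l l0 n a N b bN an h; rewrite -(ler_pM2l l0) expr2.
have : l * (l * a) <= l * (l * (l * n)) by rewrite !ler_pM2l.
rewrite -!mulrA; move: h bN; rewrite !mulrBr.
by move: (l * (l * a)) (l * (l * (l * n))) (l * N) => *; lra.
Qed.

Lemma mean_iter k f : mean (iter k step f) = mean f.
Proof. by elim: k => //= k <-; rewrite mean_step. Qed.

Lemma dot_iter_le k f : mean f = 0 ->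
  dot (iter k step f) (iter k step f) <= rate ^+ (2 * k) * dot f f.
Proof.
move=> f0; elim: k => [|k IH] /=; first by rewrite muln0 expr0 mul1r.
apply: le_trans (dot_step_step_le _) _; first by rewrite mean_iter.
by rewrite mulnS exprD -[leRHS]mulrA ler_wpM2l // exprn_ge0 // ltW // rate_gt0.
Qed.

(** Cauchy-Schwarz, as the positivity of the norm of
    [rate ^+ k * f - iter k step f]. *)
Lemma dot_iter_corr k f : mean f = 0 -> dot f (iter k step f) <= rate ^+ k * dot f f.
Proof.
move=> f0; have l0 : 0 < rate ^+ k by rewrite exprn_gt0 // rate_gt0.
have := dot_ge0 (fun a => rate ^+ k * f a - iter k step f a).
rewrite dot_combine !dot_combinel [dot (iter k step f) f]dotC.
have := dot_iter_le k f0; rewrite mulnC exprM.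
move: (rate ^+ k) l0 (dot f f) (dot f (iter k step f)) (dot _ _) => l l0 n c N h1 h2.
by rewrite -(ler_pM2l l0); nra.
Qed.

Implicit Types (F : seq S -> R).

(** The expectation of [F] over the first [k] steps from the state [a]. *)
Fixpoint path_mean (k : nat) (a : S) (F : seq S -> R) : R :=
  if k is k'.+1 then step (fun b => path_mean k' b (fun s => F (b :: s))) a
  else F [::].

Lemma ler_path_mean k a F F' :
  (forall s, size s = k -> F s <= F' s) -> path_mean k a F <= path_mean k a F'.
Proof.
elim: k a F F' => [|k IH] a F F' FF' /=; first exact: FF'.
by apply: ler_step => b; apply: IH => s ks; apply: FF'; rewrite /= ks.
Qed.

Lemma eq_path_mean k a F F' : F =1 F' -> path_mean k a F = path_mean k a F'.
Proof. by move=> /funext ->. Qed.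

Lemma path_mean_cst k a c : path_mean k a (fun=> c) = c.
Proof.
elim: k a => //= k IH a; rewrite -[RHS](step_cst c a).
by congr (step _ a); apply/funext => b; rewrite IH.
Qed.

Lemma path_mean_combine k a c F F' :
  path_mean k a (fun s => c * F s + F' s) = c * path_mean k a F + path_mean k a F'.
Proof.
elim: k a F F' => //= k IH a F F'.
rewrite [in LHS]/step; under eq_bigr do rewrite IH mulrDr mulrCA.
by rewrite big_split /= -mulr_sumr.
Qed.

Lemma path_meanZ k a c F : path_mean k a (fun s => c * F s) = c * path_mean k a F.
Proof.
rewrite -[RHS]addr0 -(path_mean_cst k a 0) -path_mean_combine.
by apply: eq_path_mean => s; rewrite addr0.
Qed.

Lemma path_mean_drop t k a F :
  path_mean (t + k) a (fun s => F (drop t s)) = iter t step (fun b => path_mean k b F) a.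
Proof.
elim: t a => [|t IH] a /=; first by apply: eq_path_mean => s; rewrite drop0.
by congr (step _ a); apply/funext => b; rewrite -IH.
Qed.

Lemma path_meanDl k a c F : path_mean k a (fun s => c + F s) = c + path_mean k a F.
Proof.
rewrite -[c in RHS](path_mean_cst k a) -[path_mean k a (fun=> c)]mul1r -path_mean_combine.
by apply: eq_path_mean => s; rewrite mul1r.
Qed.

Lemma stepD f g a : step (fun b => f b + g b) a = step f a + step g a.
Proof. by rewrite -big_split; apply: eq_bigr => b _; rewrite mulrDr. Qed.

Lemma iter_stepD k f g :
  iter k step (fun b => f b + g b) = fun a => iter k step f a + iter k step g a.
Proof.
elim: k => [|k IH] /=; first exact/funext.
by rewrite IH; apply/funext => a; rewrite stepD.
Qed.

Definition path_sum f (s : seq S) : R := \sum_(b <- s) f b.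

Lemma path_mean_sum k f a :
  path_mean k.+1 a (path_sum f) = step (fun b => f b + path_mean k b (path_sum f)) a.
Proof.
congr (step _ a); apply/funext => b; rewrite -path_meanDl.
by apply: eq_path_mean => s; rewrite /path_sum big_cons.
Qed.

(** The geometric series of the correlations [dot_iter_corr]; the bound
    [rate ^+ j * (T - 1)] is that of the infinite series, and satisfies the
    recursion exactly as [rate * T = T - 1]. *)
Lemma dot_path_mean_sum k j f : mean f = 0 ->
  dot f (iter j step (fun a => path_mean k a (path_sum f)))
  <= rate ^+ j * (T - 1) * dot f f.
Proof.
move=> f0; have l0 i : 0 <= rate ^+ i by rewrite exprn_ge0 // ltW // rate_gt0.
elim: k j => [|k IH] j.
  have -> : (fun a => path_mean 0 a (path_sum f)) = fun=> 0.
    by apply/funext => a; rewrite /= /path_sum big_nil.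
  have -> : iter j step (fun=> 0) = fun=> 0.
    by elim: j => //= j ->; apply/funext => a; rewrite step_cst.
  have -> : dot f (fun=> 0) = 0 by rewrite /dot big1 // => a _; rewrite !mulr0.
  by rewrite mulr_ge0 ?dot_ge0 // mulr_ge0 // subr_ge0 ltW.
have -> : (fun a => path_mean k.+1 a (path_sum f)) =
    step (fun b => f b + path_mean k b (path_sum f)).
  by apply/funext => a; exact: path_mean_sum.
rewrite -iterSr iter_stepD dotDr.
apply: le_trans (lerD (dot_iter_corr j.+1 f0) (IH j.+1)) _.
rewrite exprSr; move: (rate ^+ j) (dot f f) => l n.
suff -> : l * rate * n + l * rate * (T - 1) * n = l * (rate * T) * n by rewrite rate_mulT.
ring.
Qed.

(** From the stationary law, adding a first step [b] to a path increases the mean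
    square of [path_sum f] by that of [f b] plus twice the correlation of [f b]
    with the rest of the path. *)
Lemma mean_path_sqr k f : mean f = 0 ->
  mean (fun a => path_mean k a (fun s => path_sum f s ^+ 2)) <= k%:R * (2 * T * dot f f).
Proof.
move=> f0; elim: k => [|k IH].
  rewrite mul0r /mean big1 // => a _.
  by rewrite /= /path_sum big_nil expr0n mulr0.
have E a : path_mean k.+1 a (fun s => path_sum f s ^+ 2) = step (fun b =>
    f b * f b + (2 * (f b * path_mean k b (path_sum f)) + path_mean k b (fun s => path_sum f s ^+ 2))) a.
  congr (step _ a); apply/funext => b.
  rewrite mulrA -path_mean_combine -path_meanDl; apply: eq_path_mean => s.
  by rewrite /path_sum big_cons; move: (f b) (bigop _ _ _) => *; ring.
rewrite (_ : (fun a => path_mean k.+1 a _) = step (fun b => f b * f b +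
    (2 * (f b * path_mean k b (path_sum f)) + path_mean k b (fun s => path_sum f s ^+ 2)))).
  rewrite mean_step meanD meanD meanZ.
  rewrite -[mean (fun a => f a * f a)]/(dot f f).
  rewrite -[mean (fun b => f b * _)]/(dot f (fun a => path_mean k a (path_sum f))).
  have := dot_path_mean_sum k 0 f0; rewrite expr0 mul1r /=.
  have := dot_ge0 f; move: IH.
  move: (mean _) (dot f f) (dot f (fun a => path_mean k a (path_sum f))) => V n c IH n0.
  have -> : k.+1%:R * (2 * T * n) = k%:R * (2 * T * n) + 2 * (T * n).
    by rewrite -[k.+1%:R]natr1; ring.
  have -> : (T - 1) * n = T * n - n by ring.
  by move: (T * n) (k%:R * _) IH => Tn K; lra.
by apply/funext => a; exact: E.
Qed.

(** Let [h b] be the probability of [B] for a path from [b]. Its stationary mean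
    is bounded by Markov's inequality and [mean_path_sqr], and the mean of [h]
    after [t] steps from [a0] differs from it by at most [r], because the
    centred function has norm at most one and is contracted [t] times. *)
Lemma path_mean_tail (t k : nat) (a0 : S) f (B : pred (seq S)) (r c : R) :
  mean f = 0 -> 0 < w a0 -> 0 <= r -> 0 < c ->
  rate ^+ (2 * t) <= r ^+ 2 * w a0 ->
  (forall s, size s = k -> B s -> c <= path_sum f s ^+ 2) ->
  path_mean (t + k) a0 (fun s => (B (drop t s))%:R)
  <= r + k%:R * (2 * T * dot f f) / c.
Proof.
move=> f0 w0 r0 c0 rt Bc; rewrite (path_mean_drop t k a0 (fun s => (B s)%:R)).
set h := fun b => path_mean k b _.
have h01 b : 0 <= h b <= 1.
  rewrite -{1}(path_mean_cst k b 0) -(path_mean_cst k b 1) !ler_path_mean // => s _;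
  by case: (B s).
have mean_h : mean h <= k%:R * (2 * T * dot f f) / c.
  rewrite ler_pdivlMr // mulrC -meanZ; apply: le_trans (mean_path_sqr k f0).
  apply: ler_mean => b; rewrite -path_meanZ; apply: ler_path_mean => s ks.
  by have [/(Bc s ks)|_] := boolP (B s); rewrite ?mulr1 // mulr0 sqr_ge0.
pose g b := h b + - mean h.
have g0 : mean g = 0 by rewrite meanD mean_cst subrr.
have gg : dot g g <= 1.
  have -> : dot g g = dot h h - mean h ^+ 2.
    rewrite -[dot g g]/(mean (fun a => g a * g a)).
    rewrite (_ : (fun a => g a * g a) = fun a => h a * h a + ((- (2 * mean h)) * h a + mean h ^+ 2)).
      by rewrite !meanD meanZ mean_cst -[mean (fun a => h a * h a)]/(dot h h); ring.
    by apply/funext => a; rewrite /g; ring.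
  apply: (@le_trans _ _ (dot h h)); first by rewrite gerBl sqr_ge0.
  rewrite -(mean_cst 1); apply: ler_mean => b; have /andP[? ?] := h01 b.
  by rewrite mulr_ile1.
have hE : h = fun b => g b + mean h by apply/funext => b; rewrite /g subrK.
have -> : iter t step h a0 = iter t step g a0 + iter t step (fun=> mean h) a0.
  by rewrite {1}hE iter_stepD.
have -> : iter t step (fun=> mean h) a0 = mean h.
  by move: (mean h) => m; elim: t {rt} a0 {w0} => //= t IH a0; rewrite -[RHS](step_cst m a0);
    congr (step _ _); apply/funext.
rewrite lerD // -(@ler_pM2l _ 1) //.
apply: le_trans (ler_norm _) _; rewrite !mul1r.
rewrite -(@ler_pXn2r _ 2) ?nnegrE // -(ler_pM2r w0) real_normK ?num_real //.
apply: le_trans rt; apply: le_trans (le_trans (dot_iter_le t g0) _); last first.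
  by rewrite ler_piMr // exprn_ge0 // ltW // rate_gt0.
rewrite /dot (bigD1 a0) //= expr2 mulrC lerDl; apply: sumr_ge0 => b _.
by rewrite mulr_ge0 // -expr2 sqr_ge0.
Qed.
End LazyChain.

(** * The law of a Markov chain *)

Section ChainLaw.
Variables (R : realType) (S : finType) (d : measure_display) (Omega : measurableType d).
Variables (P : probability Omega R) (X : nat -> Omega -> S).
Hypothesis X_measurable : forall t a, measurable [set w | X t w = a]%classic.

Definition window (i k : nat) (w : Omega) : seq S := [seq X j w | j <- iota i k].

Lemma measurable_window i k (Q : pred (seq S)) :
  measurable [set w | Q (window i k w)]%classic.
Proof.
elim: k i Q => [|k IH] i Q.
  have [q|q] := boolP (Q [::]).
    rewrite (_ : mkset _ = setT) ?measurableT //.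
    by apply/seteqP; split=> w.
  rewrite (_ : mkset _ = set0) ?measurable0 //.
  by apply/seteqP; split=> w //= h; case/negP: q.
rewrite (_ : mkset _ = \bigcup_(b in [set: S])
    ([set w | X i w = b] `&` [set w | Q (b :: window i.+1 k w)]))%classic.
  apply: fin_bigcup_measurable => [|b _]; first exact: finite_finset.
  apply: measurableI; first exact: X_measurable.
  exact: (IH i.+1 (fun s => Q (b :: s))).
apply/seteqP; split=> w /=; first by move=> h; exists (X i w).
by move=> [b _ [<-]].
Qed.

Lemma measure_split (A : set Omega) (t : nat) : measurable A ->
  P A = (\sum_(b : S) P (A `&` [set w | X t w = b])%classic)%E.
Proof.
move=> mA; have E (r : seq S) : uniq r ->
    P (A `&` [set w | X t w \in r])%classic
    = (\sum_(b <- r) P (A `&` [set w | X t w = b])%classic)%E.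
  elim: r => [_|b r IH /= /andP[br ur]].
    rewrite big_nil (_ : setI _ _ = set0) ?measure0 //.
    by apply/seteqP; split=> w // [].
  have mr : measurable [set w | X t w \in r]%classic.
    have := measurable_window t 1 (fun s => all (mem r) s).
    by under eq_set do rewrite /= andbT.
  rewrite big_cons -IH // -measureU; [|exact: measurableI|exact: measurableI|].
    congr (P _); apply/seteqP; split=> w /=.
      by rewrite inE => -[Aw /orP[/eqP|]]; [left|right].
    by move=> [] [Aw]; [move=> ->; rewrite mem_head|rewrite inE => ->; rewrite orbT].
  by apply/seteqP; split=> w //= -[[_ ->] [_]]; rewrite (negPf br).
rewrite -big_enum /= -(E _ (enum_uniq S)).
by congr (P _); apply/seteqP; split=> w /=; [move=> Aw; rewrite mem_enum|case].
Qed.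

End ChainLaw.

Section MarkovLaw.
Variables (R : realType) (S : finType) (d : measure_display) (Omega : measurableType d).
Variables (P : probability Omega R) (p : S -> S -> R) (a0 : S) (X : nat -> Omega -> S).
Hypothesis chain : markov_chain P p a0 X.

Lemma chain_measurable t a : measurable [set w | X t w = a]%classic.
Proof. by case: chain. Qed.

Lemma measurable_past (t : nat) (a : nat -> S) :
  measurable [set w | forall i : nat, (i <= t)%N -> X i w = a i]%classic.
Proof.
have := measurable_window chain_measurable 0 t.+1 (fun s => s == [seq a i | i <- iota 0 t.+1]).
congr measurable; apply/seteqP; split=> w /=.
  move=> /eqP /eq_in_map h i it; apply: h; rewrite mem_iota //.
move=> h; apply/eqP; apply/eq_in_map => i; rewrite mem_iota => /andP[_ it]; exact: h.
Qed.

(** The law of the [k] steps after time [t] given the path up to [t], by induction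
    on [k]: split according to the next state, which then belongs to the past. *)
Lemma future_law (k t : nat) (a : nat -> S) (Q : pred (seq S)) :
  P ([set w | forall i : nat, (i <= t)%N -> X i w = a i]
     `&` [set w | Q (window X t.+1 k w)])%classic
  = (P [set w | forall i : nat, (i <= t)%N -> X i w = a i]%classic
      * (path_mean p k (a t) (fun s => (Q s)%:R))%:E)%E.
Proof.
elim: k t a Q => [|k IH] t a Q.
  rewrite /=; have [q|q] := boolP (Q [::]).
    rewrite mule1; congr (P _); apply/seteqP; split=> w /=; first by case.
    by move=> h; split.
  rewrite mule0 (_ : setI _ _ = set0) ?measure0 //.
  by apply/seteqP; split=> w //= -[_ h]; case/negP: q.
pose a' (b : S) (i : nat) := if (i <= t)%N then a i else b.
have past_a' b : [set w | forall i, (i <= t)%N -> X i w = a' b i]%classic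
    = [set w | forall i, (i <= t)%N -> X i w = a i]%classic.
  by apply/seteqP; split=> w /= h i it; have := h i it; rewrite /a' it.
have [a'_t a'_t1] : (forall b, a' b t = a t) /\ (forall b, a' b t.+1 = b).
  by rewrite /a' leqnn ltnn.
rewrite (measure_split P chain_measurable t.+1); last first.
  by apply: measurableI; [exact: measurable_past|exact: measurable_window chain_measurable _ _ _].
have [y yE] : exists y : R, P [set w | forall i, (i <= t)%N -> X i w = a i]%classic = y%:E.
  exists (fine (P [set w | forall i, (i <= t)%N -> X i w = a i]%classic)).
  by rewrite fineK // fin_num_measure //; exact: measurable_past.
have E b : P ([set w | forall i, (i <= t)%N -> X i w = a i]
      `&` [set w | Q (window X t.+1 k.+1 w)] `&` [set w | X t.+1 w = b])%classic
    = (y * (p (a t) b * path_mean p k b (fun s => (Q (b :: s))%:R)))%:E.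
  have [_ _ markov] := chain.
  have := IH t.+1 (a' b) (fun s => Q (b :: s)).
  rewrite markov past_a' yE a'_t a'_t1 mulrA !EFinM => <-.
  congr (P _); apply/seteqP; split=> w /=.
    move=> [[h q] Xb]; split; last by rewrite -Xb.
    move=> i; rewrite leq_eqVlt => /orP[/eqP ->|]; first by rewrite a'_t1.
    by rewrite ltnS => it; rewrite /a' it h.
  move=> [h q]; have Xb : X t.+1 w = b by rewrite (h t.+1) // a'_t1.
  split=> //; split; last by rewrite /window /= Xb.
  by move=> i it; rewrite (h i (leqW it)) /a' it.
rewrite yE (eq_bigr _ (fun b _ => E b)) sumEFin -EFinM -mulr_sumr.
by [].
Qed.

(** Only the trajectories from [a0] are counted on the left. *)
Lemma markov_chain_window k (Q : pred (seq S)) :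
  ((path_mean p k a0 (fun s => (Q s)%:R))%:E
   <= P [set w | Q (window X 1 k w)]%classic)%E.
Proof.
have := future_law k 0 (fun=> a0) Q.
rewrite (_ : [set w | forall i, (i <= 0)%N -> X i w = a0] = [set w | X 0%N w = a0])%classic; last first.
  by apply/seteqP; split=> w /= h => [|i]; [exact: h|rewrite leqn0 => /eqP ->].
have [_ -> _] := chain; rewrite mul1e => <-.
apply: le_measure; rewrite ?inE.
- by apply: measurableI; [exact: chain_measurable|exact: measurable_window chain_measurable _ _ _].
- exact: measurable_window chain_measurable _ _ _.
- by move=> w [].
Qed.
End MarkovLaw.

(** * The estimator *)

Section GraphSize.
Variable G : sgraph.
Hypothesis edge_exists : (1 <= #|edges G|)%N.

Lemma card_vertex_gt1 : (1 < #|G|)%N.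
Proof.
have /card_gt0P[e /edgesP[u [v [uv _]]]] := edge_exists.
rewrite ltnNge; apply/negP => /fintype_le1P /(_ u v) h.
by have := adj_neq uv; rewrite h eqxx.
Qed.

Lemma max_degree_gt0 : (0 < max_degree G)%N.
Proof.
have /card_gt0P[e /edgesP[u [v [uv _]]]] := edge_exists.
exact: leq_trans (degree_gt0 uv) (degree_le_max u).
Qed.

Lemma max_degree_le : (max_degree G <= #|G|)%N.
Proof. by apply/bigmax_leqP => u _; exact: max_card. Qed.

Lemma card_edges_le : (#|edges G| <= #|G| ^ 2)%N.
Proof.
rewrite expnS expn1 -card_prod.
pose pair_set (p : G * G) : {set G} := [set p.1; p.2].
apply: leq_trans (leq_imset_card pair_set _); apply: subset_leq_card.
apply/fintype.subsetP => e /edgesP[u [v [_ ->]]].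
by apply/imsetP; exists (u, v).
Qed.

(** A connected graph with an edge has no isolated vertices. *)
Lemma card_vertex_le : connected_graph G -> (#|G| <= 2 * #|edges G|)%N.
Proof.
move=> conn; apply: (@leq_trans #|finset.cover (edges G)|).
  apply: subset_leq_card; apply/fintype.subsetP => u _.
  suff [v uv] : exists v, adj u v.
    by apply/bigcupP; exists [set u; v]; rewrite ?edge_mem // !inE eqxx.
  have [v vu] : exists v, v != u.
    have := card_vertex_gt1; rewrite (cardD1 u) inE add1n ltnS => /card_gt0P[v].
    by rewrite !inE andbT; exists v.
  have /connectP[[|z s] /=] := conn u v; first by move=> _ e; rewrite e eqxx in vu.
  by case/andP; exists z.
apply: leq_trans (leq_card_cover (edges G)) _.
rewrite -sum1_card big_distrr /=; apply: leq_sum => e /edgesP[u [v [uv ->]]].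
by rewrite cards2 (adj_neq uv).
Qed.
End GraphSize.

Section RealBounds.
Variable R : realType.
Implicit Types q y eps z : R.

Lemma absz_ceil z : 0 <= z -> z <= (`|Num.ceil z|%N)%:R <= z + 1.
Proof.
move=> z0; rewrite natr_absz ger0_norm; last by rewrite ceil_ge0 (lt_le_trans _ z0) ?ltrN10.
by have := ceilB1_lt z; rewrite intrB ltrBlDr ceil_ge => /ltW ->.
Qed.

(** The relative tolerance [eps / (1 + eps)] on [y] becomes [eps] on [1 / y]: the
    worst case is the lower end, [y = q / (1 + eps)]. *)
Lemma inv_close q y eps : 0 < q -> 0 < eps < 1 ->
  `|y - q| < eps / (1 + eps) * q -> y != 0 /\ `|1 / y - q^-1| <= eps * q^-1.
Proof.
move=> q0 /andP[e0 e1].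
have e1' : 0 < 1 + eps by rewrite addr_gt0.
rewrite mulrAC ltr_pdivlMr // -[1 + eps]gtr0_norm // -normrM ltr_norml => /andP[h1 h2].
have y0 : 0 < y.
  by rewrite -(pmulr_lgt0 _ e1'); nra.
split; first by rewrite gt_eqF.
have -> : 1 / y - q^-1 = (q - y) / (y * q) by field; rewrite !gt_eqF.
rewrite normrM normfV (gtr0_norm (mulr_gt0 y0 q0)) ler_pdivrMr ?mulr_gt0 //.
have -> : eps * q^-1 * (y * q) = eps * y by field; rewrite gt_eqF.
by rewrite ler_norml; apply/andP; split; nra.
Qed.

End RealBounds.

Section WormEstimate.
Variables (R : realType) (G : sgraph) (beta : R).
Hypothesis edge_exists : (1 <= #|edges G|)%N.
Hypothesis beta_gt0 : 0 < beta.

Let x : R := tanhR beta.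
Let n : R := #|G|%:R.
Let m : R := #|edges G|%:R.
Let Delta : R := (max_degree G)%:R.

(** The constant of the Poincare inequality that the burn-in time and the sample
    size are calibrated for. *)
Definition worm_relaxation : R := 4 * Delta * m * n ^+ 4.

Definition worm_law (a : worm_state G) : R :=
  worm_weight x (val a) / susceptibility_sum G x.

Definition even_prob : R := (susceptibility G beta)^-1.

Definition even_deviation (a : worm_state G) : R := (val a \in C0 G)%:R - even_prob.

Let x_gt0 : 0 < x. Proof. exact: tanhR_gt0. Qed.
Let x_lt1 : x < 1. Proof. exact: tanhR_lt1. Qed.

Let n_gt1 : 1 < n.
Proof. by rewrite ltr1n card_vertex_gt1. Qed.

Let m_ge1 : 1 <= m.
Proof. by rewrite ler1n. Qed.

Let Delta_ge1 : 1 <= Delta.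
Proof. by rewrite ler1n max_degree_gt0. Qed.

Let n_gt0 : 0 < n. Proof. exact: lt_trans n_gt1. Qed.

Let m_le_n2 : m <= n ^+ 2.
Proof. by rewrite -natrX ler_nat card_edges_le. Qed.

Lemma worm_relaxation_gt1 : 1 < worm_relaxation.
Proof.
have n4 : 1 <= n ^+ 4 by rewrite exprn_ege1 // ltW // n_gt1.
apply: (@lt_le_trans _ _ 4); first by rewrite ltr1n.
have Dm : 1 <= Delta * m by rewrite -[1]mulr1 ler_pM ?Delta_ge1 ?m_ge1.
rewrite /worm_relaxation -!mulrA ler_peMr //.
by rewrite mulrA -[1]mulr1 ler_pM.
Qed.

Lemma subgraph_sum0_gt0 : 0 < subgraph_sum x (finset.set0 : {set G}).
Proof. by apply: lt_le_trans (subgraph_sum0_ge1 _ (ltW x_gt0)). Qed.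

Lemma susceptibility_sum_gt0 : 0 < susceptibility_sum G x.
Proof.
have G0 : (0 < #|G|)%N by apply: ltnW; exact: card_vertex_gt1.
rewrite -worm_weight_total (bigD1 (worm0 G)) //=.
apply: lt_le_trans (_ : worm_weight x (val (worm0 G)) <= _); first exact: worm_weight_gt0 x_gt0 _ _.
by rewrite lerDl sumr_ge0 // => a _; apply: worm_weight_ge0; exact: x_gt0.
Qed.

Lemma susceptibility_gt0 : 0 < susceptibility G beta.
Proof.
rewrite susceptibilityE divr_gt0 ?susceptibility_sum_gt0 //.
by rewrite mulr_gt0 ?n_gt0 // subgraph_sum0_gt0.
Qed.

Lemma even_prob_gt0 : 0 < even_prob.
Proof. by rewrite invr_gt0 susceptibility_gt0. Qed.

(** The susceptibility is at most the number of vertices. *)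
Lemma even_prob_ge : 1 <= n * even_prob.
Proof.
rewrite /even_prob ler_pdivlMr ?susceptibility_gt0 // mul1r susceptibilityE.
rewrite ler_pdivrMr ?mulr_gt0 ?n_gt0 ?subgraph_sum0_gt0 // mulrA -expr2.
exact: susceptibility_sum_le.
Qed.

Lemma worm_law_ge0 a : 0 <= worm_law a.
Proof.
apply: divr_ge0; first exact: worm_weight_ge0 x_gt0 _.
by rewrite ltW // susceptibility_sum_gt0.
Qed.

Lemma worm_law_sum1 : \sum_a worm_law a = 1.
Proof.
by rewrite -mulr_suml worm_weight_total mulfV // gt_eqF // susceptibility_sum_gt0.
Qed.

(** The stationary probability of having no odd vertices is the inverse of the
    susceptibility. *)
Lemma worm_law_even : \sum_(a : worm_state G | val a \in C0 G) worm_law a = even_prob.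
Proof.
by rewrite -mulr_suml worm_weight_C0 /even_prob susceptibilityE invf_div.
Qed.

Lemma mean_even : mean worm_law (fun a => (val a \in C0 G)%:R) = even_prob.
Proof.
rewrite -worm_law_even [RHS]big_mkcond; apply: eq_bigr => a _.
by case: ifP; rewrite ?mulr1 ?mulr0.
Qed.

Lemma mean_even_deviation : mean worm_law even_deviation = 0.
Proof. by rewrite meanD mean_even (mean_cst worm_law_sum1) subrr. Qed.

Lemma dot_even_deviation : dot worm_law even_deviation even_deviation <= even_prob.
Proof.
rewrite -[dot _ _ _]/(mean worm_law (fun a => even_deviation a * even_deviation a)).
have -> : (fun a => even_deviation a * even_deviation a) = (fun a =>
    (1 - 2 * even_prob) * (val a \in C0 G)%:R + even_prob ^+ 2).
  apply/funext => a; rewrite /even_deviation; case: (val a \in C0 G);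
    rewrite /= ?mulr1n ?mulr0n; move: even_prob => q; ring.
rewrite meanD meanZ mean_even (mean_cst worm_law_sum1).
by have := sqr_ge0 even_prob; rewrite expr2; move: even_prob => q; nra.
Qed.

Lemma worm_law_reversible a b :
  worm_law a * worm_transition x a b = worm_law b * worm_transition x b a.
Proof. by rewrite mulrAC worm_detailed_balance ?x_gt0 // mulrAC. Qed.

Lemma worm_step_ge0 (a b : worm_state G) : 0 <= worm_transition x a b.
Proof.
have [->|ab] := eqVneq a b; last first.
  exact: (worm_transition_ge0 x_gt0 ab).
apply: le_trans (worm_lazy x_gt0 x_lt1 _ _); first by rewrite invr_ge0.
by apply: ltnW; exact: card_vertex_gt1.
Qed.

Lemma worm_law_poincare f : mean worm_law f = 0 ->
  dot worm_law f f <= worm_relaxation / 2 *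
    \sum_a \sum_b worm_law a * worm_transition x a b * (f a - f b) ^+ 2.
Proof.
have W0 := susceptibility_sum_gt0; set W := susceptibility_sum G x in W0 *.
have -> : mean worm_law f = (\sum_(a : worm_state G) worm_weight x (val a) * f a) / W.
  by rewrite mulr_suml; apply: eq_bigr => a _; rewrite mulrAC.
have -> : dot worm_law f f = (\sum_(a : worm_state G) worm_weight x (val a) * f a ^+ 2) / W.
  by rewrite mulr_suml; apply: eq_bigr => a _; rewrite mulrAC expr2.
have -> : \sum_a \sum_b worm_law a * worm_transition x a b * (f a - f b) ^+ 2
    = (\sum_(a : worm_state G) \sum_(b : worm_state G)
      worm_weight x (val a) * worm_transition x a b * (f a - f b) ^+ 2) / W.
  rewrite mulr_suml; apply: eq_bigr => a _; rewrite mulr_suml; apply: eq_bigr => b _.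
  by rewrite /worm_law -/W; move: (W^-1) (_ ^+ 2) (worm_transition _ _ _) => *; ring.
move=> /eqP; rewrite mulf_eq0 invr_eq0 (gt_eqF W0) orbF => /eqP f0.
rewrite mulrA ler_pM2r ?invr_gt0 //.
have := worm_poincare x_gt0 x_lt1 (@subgraph_sum_le0 R G beta) (max_degree_gt0 edge_exists) f0.
move=> /le_trans; apply.
set E := \sum_a _; have E0 : 0 <= E.
  apply: sumr_ge0 => a _; apply: sumr_ge0 => b _.
  apply: mulr_ge0; last exact: sqr_ge0.
  by apply: mulr_ge0; [exact: worm_weight_ge0 x_gt0 _|exact: worm_step_ge0].
rewrite ler_wpM2r // -/Delta -/m -/n /worm_relaxation.
have -> : 4 * Delta * m * n ^+ 4 / 2 = 2 * Delta * m * n ^+ 2 * n ^+ 2 by field.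
have -> : 2 * Delta * m ^+ 2 * n ^+ 2 = 2 * Delta * m * n ^+ 2 * m by ring.
rewrite ler_wpM2l ?m_le_n2 //.
by rewrite !mulr_ge0 ?sqr_ge0 //; have := Delta_ge1; have := m_ge1; lra.
Qed.


Lemma worm_law_start : 2 ^- #|edges G| <= worm_law (worm0 G).
Proof.
rewrite /worm_law ler_pdivlMr ?susceptibility_sum_gt0 // mulrC ler_pdivrMr ?exprn_gt0 //.
by rewrite mulrC; apply: worm_weight_total_le x_gt0 x_lt1 _; exact: card_vertex_gt1.
Qed.

Section Accuracy.
Variables (eps delta : R).
Hypotheses (eps01 : 0 < eps < 1) (delta01 : 0 < delta < 1).

Let eps_gt0 : 0 < eps. Proof. by case/andP: eps01. Qed.
Let delta_gt0 : 0 < delta. Proof. by case/andP: delta01. Qed.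
Let delta_lt1 : delta < 1. Proof. by case/andP: delta01. Qed.

Lemma ln2_delta_ge0 : 0 <= ln (2 * delta^-1).
Proof.
apply: ln_ge0; apply: (@le_trans _ _ 2); first by rewrite ler1n.
by rewrite ler_peMr // invf_ge1 // ltW.
Qed.

Lemma burn_in_bounds :
  worm_relaxation * (m * ln 2 + ln (2 * delta^-1)) <= (burn_in G delta)%:R
  <= worm_relaxation * (m * ln 2 + ln (2 * delta^-1)) + 1.
Proof.
have m0 : 0 < m by apply: lt_le_trans m_ge1.
have -> : worm_relaxation * (m * ln 2 + ln (2 * delta^-1))
    = 4 * (ln 2 + ln (2 * delta^-1) / m) * Delta * m ^+ 2 * n ^+ 4.
  rewrite /worm_relaxation; move: (ln 2) (ln (2 * delta^-1)) Delta n => l l' D k.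
  by field; rewrite gt_eqF.
apply: absz_ceil; rewrite !mulr_ge0 ?addr_ge0 ?divr_ge0 ?ln2_delta_ge0 //.
by apply: ln_ge0; rewrite ler1n.
Qed.

Lemma sample_size_bounds :
  4 * worm_relaxation * n * (eps / (1 + eps)) ^- 2 / delta <= (sample_size G eps delta)%:R
  <= 4 * worm_relaxation * n * (eps / (1 + eps)) ^- 2 / delta + 1.
Proof.
have -> : 4 * worm_relaxation * n * (eps / (1 + eps)) ^- 2 / delta
    = 16 * eps ^- 2 * (1 + eps) ^+ 2 * delta^-1 * Delta * m * n ^+ 5.
  rewrite /worm_relaxation; move: Delta m n => D m' k.
  have e1 : 1 + eps != 0 by rewrite gt_eqF // addr_gt0.
  by field; rewrite e1 !gt_eqF.
apply: absz_ceil.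
by rewrite !mulr_ge0 ?invr_ge0 ?exprn_ge0 ?addr_ge0 // ltW.
Qed.

(** The burn-in brings the chain from the empty edge set within [delta / 2] of
    stationarity, since that state has stationary probability at least
    [2 ^- #|edges G|]. *)
Lemma burn_in_mixing :
  rate worm_relaxation ^+ (2 * burn_in G delta)
  <= (delta / 2) ^+ 2 * worm_law (worm0 G).
Proof.
have T0 : 0 < worm_relaxation by apply: lt_trans worm_relaxation_gt1.
have /andP[tau_ge _] := burn_in_bounds; set tau := burn_in G delta in tau_ge *.
have rate_exp : rate worm_relaxation <= expR (- worm_relaxation^-1).
  by rewrite /rate; exact: expR_ge1Dx.
have step1 : rate worm_relaxation ^+ tau <= expR (- (worm_relaxation^-1 * tau%:R)).
  by rewrite -mulNr expRM_natr lerXn2r ?nnegrE ?expR_ge0 // ltW // rate_gt0 // worm_relaxation_gt1.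
have step2 : expR (- (worm_relaxation^-1 * tau%:R)) <= 2 ^- #|edges G| * (delta / 2).
  have -> : 2 ^- #|edges G| * (delta / 2) = expR (- (m * ln 2 + ln (2 * delta^-1))).
    rewrite expRN expRD expRM_natl !lnK ?posrE ?divr_gt0 //.
    by rewrite invfM invf_div.
  by rewrite ler_expR lerN2 [_^-1 * _]mulrC ler_pdivlMr // mulrC.
rewrite mulnC exprM.
apply: (@le_trans _ _ ((2 ^- #|edges G| * (delta / 2)) ^+ 2)).
  rewrite lerXn2r ?nnegrE ?exprn_ge0 //.
  - by rewrite ltW // rate_gt0 // worm_relaxation_gt1.
  - by rewrite mulr_ge0 ?invr_ge0 ?exprn_ge0 ?divr_ge0 // ltW.
  - exact: le_trans step2.
rewrite exprMn mulrC ler_wpM2l ?sqr_ge0 //; apply: le_trans worm_law_start.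
rewrite expr2 ler_piMr ?invr_ge0 ?exprn_ge0 // invf_le1 ?exprn_gt0 //.
by rewrite exprn_ege1 // ler1n.
Qed.

Definition even_fraction (s : seq (worm_state G)) : R :=
  (sample_size G eps delta)%:R^-1 * \sum_(a <- s) (val a \in C0 G)%:R.

Definition accurate (s : seq (worm_state G)) : bool :=
  (even_fraction s != 0) &&
  (`|1 / even_fraction s - susceptibility G beta| <= eps * susceptibility G beta).

Definition tolerance : R := (sample_size G eps delta)%:R * (eps / (1 + eps) * even_prob).

Let ratio_gt0 : 0 < eps / (1 + eps).
Proof. by rewrite divr_gt0 // addr_gt0. Qed.

Lemma sample_size_gt0 : 0 < (sample_size G eps delta)%:R :> R.
Proof.
have /andP[h _] := sample_size_bounds; apply: lt_le_trans h.
rewrite divr_gt0 // mulr_gt0 ?invr_gt0 ?exprn_gt0 // mulr_gt0 ?n_gt0 // mulr_gt0 //.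
exact: lt_trans worm_relaxation_gt1.
Qed.

Lemma inaccurate_deviation s : size s = sample_size G eps delta -> ~~ accurate s ->
  tolerance ^+ 2 <= path_sum even_deviation s ^+ 2.
Proof.
move=> sizes; apply: contraR; rewrite -ltNge => dev.
have N0 := sample_size_gt0; set N := sample_size G eps delta in N0 sizes *.
have E : path_sum even_deviation s = N%:R * (even_fraction s - even_prob).
  rewrite /path_sum /even_deviation sumrB mulrBr /even_fraction mulrA mulfV ?gt_eqF // mul1r.
  by rewrite big_const_seq count_predT sizes iter_addr_0 mulr_natl.
have close : `|even_fraction s - even_prob| < eps / (1 + eps) * even_prob.
  rewrite -(ltr_pM2l N0) -[X in X * `|_|]gtr0_norm // -normrM -E.
  rewrite -/N -(@ltr_pXn2r _ 2) ?nnegrE //; first by rewrite real_normK ?num_real.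
  by apply/ltW; rewrite mulr_gt0 // mulr_gt0 ?even_prob_gt0.
have [f0 f1] := inv_close even_prob_gt0 eps01 close.
by rewrite /accurate f0 /=; move: f1; rewrite /even_prob invrK.
Qed.

(** Chebyshev's bound on the error of the stationary average; the variance of the
    indicator is at most [even_prob], itself at least [1 / n]. *)
Lemma tolerance_variance :
  (sample_size G eps delta)%:R * (2 * worm_relaxation * dot worm_law even_deviation even_deviation)
    / tolerance ^+ 2 <= delta / 2.
Proof.
have /andP[N_ge _] := sample_size_bounds; have N0 := sample_size_gt0.
rewrite /tolerance; set N := (sample_size G eps delta)%:R in N_ge N0 *.
have v := dot_even_deviation; have q0 := even_prob_gt0; have nq := even_prob_ge.
have T0 : 0 < worm_relaxation by apply: lt_trans worm_relaxation_gt1.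
move: worm_relaxation even_prob (dot _ _ _) (eps / (1 + eps)) ratio_gt0 T0 N_ge v q0 nq.
move=> T q V r r0 T0 N_ge vq q0 nq.
rewrite ler_pdivrMr ?exprn_gt0 ?mulr_gt0 //.
have NT : 4 * T <= N * r ^+ 2 * q * delta.
  move: N_ge; rewrite ler_pdivrMr // ler_pdivrMr ?exprn_gt0 // => N_ge.
  have -> : N * r ^+ 2 * q * delta = (N * delta * r ^+ 2) * q by ring.
  apply: (@le_trans _ _ (4 * T * n * q)); last by rewrite ler_pM2r.
  by rewrite -[4 * T * n * q]mulrA ler_peMr // mulr_ge0 // ltW.
apply: (@le_trans _ _ (N * (2 * T * q))).
  by rewrite ler_pM2l // ler_wpM2l // mulr_ge0 // ltW.
have -> : N * (2 * T * q) = (N * q / 2) * (4 * T) by field.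
have -> : delta / 2 * (N * (r * q)) ^+ 2 = (N * q / 2) * (N * r ^+ 2 * q * delta) by field.
by rewrite ler_pM2l // divr_gt0 // mulr_gt0.
Qed.

Lemma accurate_path_mean :
  1 - delta <= path_mean (worm_transition x) (burn_in G delta + sample_size G eps delta)
    (worm0 G) (fun s => (accurate (drop (burn_in G delta) s))%:R).
Proof.
have tail := path_mean_tail worm_step_ge0 (worm_transition_sum1 x) worm_law_ge0
  worm_law_sum1 worm_law_reversible _ worm_relaxation_gt1 worm_law_poincare
  mean_even_deviation.
have half_ge0 : 0 <= delta / 2 by rewrite divr_ge0 // ltW.
have tol2 : 0 < tolerance ^+ 2.
  by rewrite exprn_gt0 // mulr_gt0 ?sample_size_gt0 // mulr_gt0 ?even_prob_gt0.
have start0 : 0 < worm_law (worm0 G).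
  by apply: lt_le_trans worm_law_start; rewrite invr_gt0 exprn_gt0.
have lazyw (a : worm_state G) : 2^-1 <= worm_transition x a a.
  by apply: worm_lazy x_gt0 x_lt1 _ _; apply: ltnW; exact: card_vertex_gt1.
have {tail} := tail lazyw (burn_in G delta) (sample_size G eps delta) (worm0 G)
  (fun s => ~~ accurate s) _ _ start0 half_ge0 tol2 burn_in_mixing inaccurate_deviation.
set t := burn_in G delta; set N := sample_size G eps delta => tail.
have -> : path_mean (worm_transition x) (t + N) (worm0 G) (fun s => (accurate (drop t s))%:R)
    = 1 - path_mean (worm_transition x) (t + N) (worm0 G) (fun s => (~~ accurate (drop t s))%:R).
  have -> : (fun s => (accurate (drop t s))%:R) = (fun s => -1 * (~~ accurate (drop t s))%:R + 1 : R).
    by apply/funext => s; case: (accurate _); rewrite /= ?mulr0 ?mulr1 ?add0r ?addNr.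
  rewrite path_mean_combine path_mean_cst; last exact: worm_transition_sum1.
  by rewrite mulN1r addrC.
by have := tolerance_variance; rewrite -/N; move: tail; lra.
Qed.

End Accuracy.

End WormEstimate.

(** * The approximation scheme *)

Section Scheme.
Variable R : realType.
Implicit Types (G : sgraph) (beta eps delta : R).

Lemma S0_hat_window G eps delta (d : measure_display) (Omega : measurableType d)
    (X : nat -> Omega -> worm_state G) (w : Omega) :
  S0_hat eps delta (X ^~ w) = even_fraction eps delta
    (drop (burn_in G delta) (window X 1 (burn_in G delta + sample_size G eps delta) w)).
Proof.
rewrite /S0_hat /even_fraction /window -map_drop drop_iota add1n addnC addnK big_map.
by rewrite /index_iota subSS addnK.
Qed.

Lemma worm_estimate_ge G beta eps delta (d : measure_display) (Omega : measurableType d)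
    (P : probability Omega R) (X : nat -> Omega -> worm_state G)
    (Q : pred (seq (worm_state G))) :
  (1 <= #|edges G|)%N -> 0 < beta -> 0 < eps < 1 -> 0 < delta < 1 ->
  worm_process (tanhR beta) P X -> (forall s, accurate beta eps delta s -> Q s) ->
  ((1 - delta)%:E <= P [set w |
     Q (drop (burn_in G delta)
         (window X 1 (burn_in G delta + sample_size G eps delta) w))]%classic)%E.
Proof.
move=> E1 b0 e01 d01 XP accQ.
apply: le_trans (markov_chain_window XP _ (fun s => Q (drop (burn_in G delta) s))).
rewrite lee_fin; apply: le_trans (accurate_path_mean E1 b0 e01 d01) _.
apply: ler_path_mean => [a b|s _]; first exact: worm_step_ge0.
by have := accQ (drop (burn_in G delta) s); case: accurate => // ->.
Qed.

Lemma ln_le_self (z : R) : 0 < z -> ln z <= z.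
Proof.
move=> z0; have {1}-> : z = 1 + (z - 1) by rewrite addrC subrK.
by apply: le_trans (le_ln1Dx _) _; rewrite ?gerBl // ltrBrDr addNr.
Qed.

(** The two terms are at most 128 (sample) and 12 (burn-in) times
    [u * v * D * m ^+ 2 * n4], and each is rounded up. *)
Lemma run_length_arith (D m n n4 u v l L r : R) :
  1 <= D -> 1 <= m -> 1 <= n4 -> 1 <= u -> 1 <= v -> 0 <= n -> n <= 2 * m -> l <= 1 ->
  L <= 2 * u -> 0 <= r -> r <= 4 * v ->
  4 * (4 * D * m * n4) * n * r * u + 1 + (4 * D * m * n4 * (m * l + L) + 1)
  <= 142 * (u * v * D * m ^+ 2 * n4).
Proof.
move=> D1 m1 n41 u1 v1 n0 n_le l_le L_le r0 r_le; set Y := u * v * D * m ^+ 2 * n4.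
have ge0 (z : R) : 1 <= z -> 0 <= z by apply: le_trans.
have [D0 m0 n40 u0 v0] : [/\ 0 <= D, 0 <= m, 0 <= n4, 0 <= u & 0 <= v] by split; exact: ge0.
have Y1 : 1 <= Y by rewrite /Y; do !(apply: mulr_ege1 => //); rewrite expr2 mulr_ege1.
have tauY : 4 * D * m * n4 * (m * l + L) <= 12 * Y.
  apply: (@le_trans _ _ (4 * D * m * n4 * (3 * (u * m)))).
    rewrite ler_wpM2l //; first by rewrite !mulr_ge0.
    have : m * l <= m by rewrite ler_piMr.
    have : m <= u * m by rewrite ler_peMl.
    have : u <= u * m by rewrite ler_peMr.
    by move: (u * m) (m * l) L_le => p q; lra.
  have -> : 4 * D * m * n4 * (3 * (u * m)) = 12 * (u * D * m ^+ 2 * n4) by ring.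
  have -> : Y = u * D * m ^+ 2 * n4 * v by rewrite /Y; ring.
  have k0 : 0 <= u * D * m ^+ 2 * n4 by rewrite mulr_ge0 // mulr_ge0 ?sqr_ge0 // mulr_ge0.
  by rewrite ler_wpM2l // ler_peMr.
have NY : 4 * (4 * D * m * n4) * n * r * u <= 128 * Y.
  have -> : 4 * (4 * D * m * n4) * n * r * u = 16 * (D * m * n4 * u) * (n * r) by ring.
  have -> : 128 * Y = 16 * (D * m * n4 * u) * (2 * m * (4 * v)) by rewrite /Y; ring.
  by rewrite ler_wpM2l ?ler_pM // mulr_ge0 // !mulr_ge0.
by move: tauY NY Y1; lra.
Qed.

Lemma run_length_le G eps delta :
  connected_graph G -> (1 <= #|edges G|)%N -> 0 < eps < 1 -> 0 < delta < 1 ->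
  (sample_size G eps delta + burn_in G delta)%:R
    <= 142 * (delta^-1 * eps ^- 2 * (max_degree G)%:R * #|edges G|%:R ^+ 2 * #|G|%:R ^+ 4).
Proof.
move=> conn E1 e01 d01.
have /andP[_ tau_le] := burn_in_bounds E1 d01.
have /andP[_ N_le] := sample_size_bounds G e01 d01.
rewrite natrD; apply: le_trans (lerD N_le tau_le) _.
have [d0 d1] := andP d01; have [e0 e1] := andP e01.
have u1 : 1 <= delta^-1 by rewrite invf_ge1 // ltW.
have e1' : 0 < 1 + eps by rewrite addr_gt0.
apply: run_length_arith.
- by rewrite ler1n max_degree_gt0.
- by rewrite ler1n.
- by rewrite exprn_ege1 // ler1n ltnW // card_vertex_gt1.
- by [].
- by rewrite invf_ge1 ?exprn_gt0 // exprn_ile1 // ltW.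
- by [].
- by rewrite -natrM ler_nat card_vertex_le.
- by have := @le_ln1Dx R 1; apply; rewrite (lt_trans (@ltrN10 R)).
- by rewrite ln_le_self // mulr_gt0 // invr_gt0.
- by rewrite invr_ge0 sqr_ge0.
have -> : (eps / (1 + eps)) ^- 2 = (1 + eps) ^+ 2 * eps ^- 2.
  by field; rewrite !gt_eqF.
have e2 : 1 + eps <= 2 by rewrite (_ : 2 = 1 + 1) // lerD2l ltW.
have -> : 4 = 2 * 2 :> R by rewrite -natrM.
by rewrite ler_wpM2r ?invr_ge0 ?sqr_ge0 // expr2 ler_pM // ltW.
Qed.

Lemma run_length_poly G eps delta :
  (1 <= #|edges G|)%N -> 0 < eps -> 0 < delta ->
  142 * (delta^-1 * eps ^- 2 * (max_degree G)%:R * #|edges G|%:R ^+ 2 * #|G|%:R ^+ 4)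
  <= 142 * (#|G|%:R ^+ 9 * (eps^-1 ^+ 2 * delta^-1)).
Proof.
move=> E1 e0 d0; rewrite ler_wpM2l //.
have D_le : (max_degree G)%:R <= #|G|%:R :> R by rewrite ler_nat max_degree_le.
have m_le : #|edges G|%:R ^+ 2 <= #|G|%:R ^+ 4 :> R.
  by rewrite -!natrX ler_nat (_ : #|G| ^ 4 = (#|G| ^ 2) ^ 2)%N ?leq_exp2r ?card_edges_le // -expnM.
have c0 : 0 <= delta^-1 * eps ^- 2 by rewrite mulr_ge0 ?invr_ge0 ?exprn_ge0 // ltW.
have -> : #|G|%:R ^+ 9 * (eps^-1 ^+ 2 * delta^-1)
    = delta^-1 * eps ^- 2 * (#|G|%:R * #|G|%:R ^+ 4) * #|G|%:R ^+ 4.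
  by rewrite exprVn; move: (eps ^- 2) (delta^-1) (#|G|%:R) => *; ring.
rewrite ler_wpM2r ?exprn_ge0 // -[leLHS]mulrA ler_wpM2l // ler_pM ?exprn_ge0 //.
Qed.

Lemma horner_monomial (S : comNzRingType) (k : nat) (c a : S) :
  (c%:P * 'X^k).[a] = c * a ^+ k.
Proof. by rewrite hornerM hornerC hornerXn. Qed.

(** [142 * n ^+ 9 * y ^+ 2 * z] in nested univariate polynomials. *)
Definition run_poly : {poly {poly {poly R}}} :=
  ((142%:P * 'X^1)%:P * 'X^2)%:P * 'X^9.

Lemma run_polyE (n : nat) (y z : R) :
  (run_poly.[n%:R]).[y%:P].[z] = 142 * (n%:R ^+ 9 * (y ^+ 2 * z)).
Proof.
rewrite /run_poly -(polyC_natr {poly R}) -(polyC_natr R).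
rewrite (horner_monomial 9) -polyC_exp mulrAC -polyCM (horner_monomial 2) -polyC_exp -polyC_exp.
rewrite [X in (X * _).[z]](_ : _ = (142 * n%:R ^+ 9)%:P * 'X^1); last first.
  by rewrite polyCM mulrAC.
by rewrite mulrAC -polyCM (horner_monomial 1) expr1; ring.
Qed.

End Scheme.

Theorem mainTheorem2 (R : realType) :
  [/\ forall (G : sgraph) (beta eps delta : R),
        connected_graph G -> (1 <= #|edges G|)%N -> 0 < beta ->
        0 < eps < 1 -> 0 < delta < 1 ->
        forall (d : measure_display) (Omega : measurableType d)
          (P : probability Omega R) (X : nat -> Omega -> worm_state G),
          worm_process (tanhR beta) P X ->
          ((1 - delta)%:E <=
             P [set w | (S0_hat eps delta (X ^~ w) <> 0)%R /\
                        (`|1 / S0_hat eps delta (X ^~ w) - susceptibility G beta|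
                          <= eps * susceptibility G beta)%R]%classic)%E,
      exists C : R, 0 < C /\
        forall (G : sgraph) (eps delta : R),
          connected_graph G -> (1 <= #|edges G|)%N ->
          0 < eps < 1 -> 0 < delta < 1 ->
          (sample_size G eps delta + burn_in G delta)%:R
            <= C * (delta^-1 * eps ^- 2 * (max_degree G)%:R
                    * #|edges G|%:R ^+ 2 * #|G|%:R ^+ 4) &
      fpras (@susceptibility R) (susceptibility_algorithm R)].
Proof.
split.
- move=> G beta eps delta _ E1 b0 e01 d01 d Omega P X XP.
  have := worm_estimate_ge E1 b0 e01 d01 XP (fun s h => h).
  congr (_ <= P _)%E; apply/seteqP; split=> w /=; rewrite S0_hat_window.
    by move=> /andP[/eqP].
  by move=> [/eqP ? ?]; apply/andP.
- exists 142; split=> // G eps delta conn E1 e01 d01; exact: run_length_le.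
exists (run_poly R) => G beta eps delta conn E1 b0 e01 d01; split.
- rewrite run_polyE; apply: le_trans (run_length_le conn E1 e01 d01) _.
  by apply: run_length_poly => //; [case/andP: e01|case/andP: d01].
- move=> traj traj' eq_traj /=; congr (_^-1); rewrite /S0_hat; congr (_ * _).
  rewrite big_nat [RHS]big_nat; apply: eq_bigr => t /andP[_ t_le].
  by rewrite eq_traj //= addnC -ltnS.
move=> d Omega P X XP; rewrite /eps_delta_approximation /=.
have close (s : seq (worm_state G)) : accurate beta eps delta s ->
    `|(even_fraction eps delta s)^-1 - susceptibility G beta| <= eps * susceptibility G beta.
  by move=> /andP[_]; rewrite div1r.
have := worm_estimate_ge E1 b0 e01 d01 XP close; congr (_ <= P _)%E.
by apply/seteqP; split=> w /=; rewrite S0_hat_window.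
Qed.
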